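(* Consider a free isometric action of the torus $T^k$ on a connected Riemannian manifold $M$ with nonnegative sectional curvature. If $M$ is simply connected, then the quotient submersion $\pi:M\to M/T^k$ is twisted.
   Context: Here $T^k$ is the $k$-dimensional torus, and the orbit space $M/T^k$ carries the Riemannian metric for which the quotient map $\pi:M\to M/T^k$ is a Riemannian submersion. A horizontal curve of a Riemannian submersion $\pi:M\to B$ is a curve in $M$ that is orthogonal to the fibers of $\pi$ at every point. The dual leaf through $p\in M$ is the set of all points of $M$ that can be reached from $p$ by horizontal curves; the collection of dual leaves is the dual foliation associated to the fibers of $\pi$. The submersion $\pi$ is called twisted if this dual foliation contains only one leaf, i.e. any two points of $M$ can be joined by a horizontal curve. *)

(* Defs.v *)
From HB Require Import structures.
From mathcomp Require Import all_boot all_order all_algebra.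
From mathcomp Require Import generic_quotient ring_quotient.
From mathcomp Require Import all_classical all_reals all_analysis.

Set Implicit Arguments.
Unset Strict Implicit.
Unset Printing Implicit Defensive.

Import Order.TTheory GRing.Theory Num.Theory.
Import numFieldNormedType.Exports.

Local Open Scope classical_set_scope.
Local Open Scope ring_scope.
Local Open Scope quotient_scope.

(* f is C^oo on U: every iterated directional derivative of f is Frechet
   differentiable at every point of U.  Only meant for U open and E finite
   dimensional. *)
Definition smooth_on (R : realType) (E F : normedModType R) (U : set E)
    (f : E -> F) : Prop :=
  forall (vs : seq E) (x : E), U x ->
    differentiable (foldr (fun v g => 'D_v g) f vs) x.

Record chart (R : realType) (n : nat) (M : topologicalType) := Chart {
  cdom : set M;
  ccod : set 'rV[R]_n;
  cmap : M -> 'rV[R]_n;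
  cinv : 'rV[R]_n -> M;
  cdom_open : open cdom;
  ccod_open : open ccod;
  cmap_fun : forall p, cdom p -> ccod (cmap p);
  cinv_fun : forall x, ccod x -> cdom (cinv x);
  cmapK : forall p, cdom p -> cinv (cmap p) = p;
  cinvK : forall x, ccod x -> cmap (cinv x) = x;
  cmap_continuous : {within cdom, continuous cmap};
  cinv_continuous : {within ccod, continuous cinv}
}.

(* The atlas is not required to be maximal. *)
Record manifold (R : realType) (n : nat) := Manifold {
  mcarrier :> topologicalType;
  atlas : set (chart R n mcarrier);
  manifold_hausdorff : hausdorff_space mcarrier;
  manifold_second_countable : @second_countable mcarrier;
  atlas_cover : forall p : mcarrier, exists2 c, atlas c & cdom c p;
  atlas_compatible : forall c d, atlas c -> atlas d ->
    smooth_on [set x | ccod c x /\ cdom d (cinv c x)] (cmap d \o cinv c)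
}.

Definition gdot (R : realType) (n : nat) (G : 'M[R]_n) (u v : 'rV[R]_n) : R :=
  (u *m G *m v^T) 0 0.

(* A tangent vector at p is represented, in each chart c around p, by its
   coordinate vector; under a map F of M, the coordinate vector v at x in
   chart c becomes 'D_v (cmap d \o F \o cinv c) x in chart d.  A field of
   Gram matrices g c x on the codomains of the charts is preserved by F when
   the differential of F is an isometry at every point. *)
Definition preserves_gram (R : realType) (n : nat) (M : manifold R n)
    (g : chart R n M -> 'rV[R]_n -> 'M[R]_n) (F : M -> M) : Prop :=
  forall c d, atlas c -> atlas d ->
  forall x, ccod c x -> cdom d (F (cinv c x)) ->
  let f := cmap d \o F \o cinv c in
  forall u v, gdot (g d (f x)) ('D_u f x) ('D_v f x) = gdot (g c x) u v.

Record riemannian_metric (R : realType) (n : nat) (M : manifold R n) :=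
  RiemannianMetric {
  gram :> chart R n M -> 'rV[R]_n -> 'M[R]_n;
  gram_smooth : forall c, atlas c -> smooth_on (ccod c) (gram c);
  gram_sym : forall c, atlas c -> forall x, ccod c x ->
    (gram c x)^T = gram c x;
  gram_posdef : forall c, atlas c -> forall x, ccod c x ->
    forall v, v != 0 -> 0 < gdot (gram c x) v v;
  gram_transition : preserves_gram gram id
}.

Section Curvature.
Variables (R : realType) (n : nat) (g : 'rV[R]_n -> 'M[R]_n).
Local Notation e i := (delta_mx 0 i : 'rV[R]_n).

(* Gamma^k_{ij} *)
Definition christoffel (x : 'rV[R]_n) (k i j : 'I_n) : R :=
  2^-1 * \sum_l invmx (g x) k l *
    ('D_(e i) (fun y => g y j l) x + 'D_(e j) (fun y => g y i l) x
     - 'D_(e l) (fun y => g y i j) x).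

(* The l-th coordinate of R(e_i, e_j) e_k, for the convention
   R(X, Y) = [nabla_X, nabla_Y] - nabla_[X, Y]. *)
Definition riemann_curvature (x : 'rV[R]_n) (i j k l : 'I_n) : R :=
  'D_(e i) (fun y => christoffel y l j k) x
  - 'D_(e j) (fun y => christoffel y l i k) x
  + \sum_m (christoffel x l i m * christoffel x m j k
            - christoffel x l j m * christoffel x m i k).

Definition curvature_vector (x u v w : 'rV[R]_n) : 'rV[R]_n :=
  \row_l \sum_i \sum_j \sum_k
    u 0 i * v 0 j * w 0 k * riemann_curvature x i j k l.

(* The denominator is nonzero when u and v are linearly independent. *)
Definition sectional_curvature (x u v : 'rV[R]_n) : R :=
  gdot (g x) (curvature_vector x u v v) u
  / (gdot (g x) u u * gdot (g x) v v - gdot (g x) u v ^+ 2).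

End Curvature.

Definition nonneg_sectional_curvature (R : realType) (n : nat)
    (M : manifold R n) (g : riemannian_metric M) : Prop :=
  forall c, atlas c -> forall x, ccod c x ->
  forall u v : 'rV[R]_n, row_free (col_mx u v) ->
    0 <= sectional_curvature (g c) x u v.

Definition is_path (R : realType) (M : topologicalType) (p q : M)
    (gamma : R -> M) : Prop :=
  [/\ {within `[0, 1]%classic, continuous gamma}, gamma 0 = p & gamma 1 = q].

Definition simply_connected (R : realType) (M : topologicalType) : Prop :=
  (forall p q : M, exists gamma : R -> M, is_path p q gamma) /\
  (forall (p : M) (gamma : R -> M), is_path p p gamma ->
     exists H : R * R -> M,
       [/\ {within `[0, 1]%classic `*` `[0, 1]%classic, continuous H},
           (forall t, t \in `[0, 1] -> H (0, t) = gamma t),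
           (forall t, t \in `[0, 1] -> H (1, t) = p) &
           (forall s, s \in `[0, 1] -> H (s, 0) = p /\ H (s, 1) = p)]).

Definition int_lattice (R : realType) (k : nat) : {pred 'rV[R]_k} :=
  fun v => v \is a mxOver Num.int.

Fact int_lattice_zmod_closed (R : realType) (k : nat) :
  zmod_closed (@int_lattice R k).
Proof.
split=> [|u v /mxOverP Zu /mxOverP Zv]; apply/mxOverP => i j.
  by rewrite mxE rpred0.
by rewrite !mxE rpredB.
Qed.

HB.instance Definition _ (R : realType) (k : nat) :=
  GRing.isZmodClosed.Build 'rV[R]_k (@int_lattice R k)
    (@int_lattice_zmod_closed R k).

(* T^k = R^k / Z^k, written additively. *)
Definition torus (R : realType) (k : nat) : zmodType :=
  Quotient.quot (@int_lattice R k : zmodClosed _).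

Definition torus_proj (R : realType) (k : nat) (s : 'rV[R]_k) : torus R k :=
  \pi_(Quotient.quot (@int_lattice R k : zmodClosed _)) s.

Lemma torus_projD (R : realType) (k : nat) (s t : 'rV[R]_k) :
  torus_proj (s + t) = torus_proj s + torus_proj t.
Proof. exact: Quotient.pi_add. Qed.

Lemma torus_proj_eq (R : realType) (k : nat) (s t : 'rV[R]_k) :
  torus_proj s = torus_proj t <-> s - t \is a mxOver Num.int.
Proof.
split=> [/eqP|st]; first by rewrite -Quotient.idealrBE.
by apply/eqP; rewrite -Quotient.idealrBE.
Qed.

(* As torus_proj is a surjective local diffeomorphism, the action is smooth
   on T^k x M iff its pullback to R^k x M is. *)
Definition smooth_torus_action (R : realType) (k n : nat) (M : manifold R n)
    (act : torus R k -> M -> M) : Prop :=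
  [/\ (forall p, act 0 p = p),
      (forall s t p, act (s + t) p = act s (act t p)),
      continuous (fun z : 'rV[R]_k * M => act (torus_proj z.1) z.2) &
      forall c d, atlas c -> atlas d ->
        smooth_on
          [set z : 'rV[R]_k * 'rV[R]_n |
            ccod c z.2 /\ cdom d (act (torus_proj z.1) (cinv c z.2))]
          (fun z => cmap d (act (torus_proj z.1) (cinv c z.2)))].

Definition isometric_action (R : realType) (k n : nat) (M : manifold R n)
    (g : riemannian_metric M) (act : torus R k -> M -> M) : Prop :=
  forall t, preserves_gram g (act t).

Definition free_action (R : realType) (k n : nat) (M : manifold R n)
    (act : torus R k -> M -> M) : Prop :=
  forall t p, act t p = p -> t = 0.

Section OrbitSpace.
Variables (R : realType) (k n : nat) (M : manifold R n).
Variable act : torus R k -> M -> M.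

Definition orbit_of (p : M) : set M := range (act^~ p).

Definition orbit_space := {O : set M | exists p, O = orbit_of p}.

Definition orbit_proj (p : M) : orbit_space :=
  exist _ (orbit_of p) (ex_intro _ p erefl).

End OrbitSpace.

Section Twisted.
Variables (R : realType) (n : nat) (M : manifold R n).
Variables (g : riemannian_metric M) (B : Type) (pi : M -> B).

Definition smooth_curve (U : set R) (gamma : R -> M) : Prop :=
  [/\ open U,
      (forall t, U t -> {for t, continuous gamma}) &
      forall c, atlas c ->
        smooth_on (U `&` gamma @^-1` cdom c) (cmap c \o gamma)].

Definition velocity (c : chart R n M) (gamma : R -> M) (t : R) : 'rV[R]_n :=
  derive1 (cmap c \o gamma) t.

(* v represents, in the chart c, a vector tangent at p to the fiber of pi
   through p. *)
Definition tangent_to_fiber (c : chart R n M) (p : M) (v : 'rV[R]_n) : Prop :=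
  exists tau : R -> M,
    [/\ smooth_curve setT tau, tau 0 = p,
        (forall s, pi (tau s) = pi p) & velocity c tau 0 = v].

Definition orthogonal_to_fiber (gamma : R -> M) (t : R) : Prop :=
  forall c, atlas c -> cdom c (gamma t) ->
  forall v, tangent_to_fiber c (gamma t) v ->
    gdot (g c (cmap c (gamma t))) (velocity c gamma t) v = 0.

(* gamma restricted to [a, b] extends to a smooth curve on an open
   neighbourhood of [a, b], which is orthogonal to the fibers over [a, b]. *)
Definition smooth_horizontal_arc (a b : R) (gamma : R -> M) : Prop :=
  exists U sigma,
    [/\ smooth_curve U sigma, `[a, b]%classic `<=` U,
        {in `[a, b], gamma =1 sigma} &
        forall t, t \in `[a, b] -> orthogonal_to_fiber sigma t].

(* Horizontal curves are piecewise smooth, so that they can be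
   concatenated. *)
Definition horizontal_curve (a b : R) (gamma : R -> M) : Prop :=
  exists2 s, itv_partition a b s &
    forall i, (i < size s)%N ->
      smooth_horizontal_arc (nth b (a :: s) i) (nth b (a :: s) i.+1) gamma.

Definition dual_leaf (p : M) : set M :=
  [set q | exists a b gamma,
     [/\ horizontal_curve a b gamma, gamma a = p & gamma b = q]].

Definition twisted : Prop := forall p q : M, dual_leaf p q.

End Twisted.

(* Main.v *)
Require Import Defs.
From HB Require Import structures.
From mathcomp Require Import all_boot all_order all_algebra.
From mathcomp Require Import all_classical all_reals all_analysis.
From mathcomp Require Import ring lra.

(** Let [omega] be the R^k-valued connection form whose kernel is the
    horizontal distribution.  Moving a curve [x] of M by [- \int omega] along
    the orbits makes it horizontal; hence the set [holonomy] of all s in R^k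
    such that p and s p can be joined by a horizontal curve does not depend on
    p, is a subgroup containing Z^k, and contains the periods of [omega] over
    small loops.  The velocities of the paths of [holonomy] form a linear
    subspace.  If it is all of R^k, then [holonomy] is open by a contraction
    argument, so it is R^k and the submersion is twisted.  Otherwise a nonzero
    linear form [l] vanishes on these velocities, so the periods of [l omega]
    over small loops vanish and [l omega] has local primitives.  As M is simply
    connected, its integral along the loop t |-> t e_j . p is zero; but it is
    equal to l e_j, so l = 0, a contradiction. *)

Set Implicit Arguments.
Unset Strict Implicit.
Unset Printing Implicit Defensive.

Import Order.TTheory GRing.Theory Num.Theory.
Import numFieldNormedType.Exports.

Local Open Scope classical_set_scope.
Local Open Scope ring_scope.

(** * Smooth functions *)

(** The obstacle is that [holonomy] is a bare subgroup of R^k, not known to be closed or to be a Lie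
    subgroup; all that is at hand are paths inside it that come from integrals of [omega]. Two
    operations on such paths are enough. Adding paths and rescaling their parameter stays in the
    subgroup, which is why the velocities at 0 form a linear subspace. Translating a path back to 0
    by one of its own values stays in the subgroup as well, so a linear form that kills all
    velocities at 0 kills the velocity at every time and is constant along the path. This takes the
    place of the curvature of [omega] and of the Stokes formula: [l omega] is handled only through
    its local primitives, and closedness means that two of them differ by a locally constant
    function. The torus being commutative is used twice: Killing fields are invariant under the
    action, and the holonomy of p does not change when p moves. *)

Section NearEq.
Context {R : numFieldType} {V W : normedModType R}.

Lemma near_eq_differentiable (f g : V -> W) (x : V) :
  (\near x, f x = g x) -> differentiable f x -> differentiable g x.
Proof.
move=> fg df.
have gl : g \o shift x = cst (g x) + 'd f x +o_ 0 id.
  apply: (iffRL (eqaddoP _ _ _ _)) => e e0.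
  have /(_ e e0) := iffLR (eqaddoP _ _ _ _) (diff_locally df).
  have fg0 : \forall h \near 0, f (h + x) = g (h + x).
    by move: fg; rewrite (near_shift 0) /=; apply: filterS => y; rewrite /= subr0.
  move=> fe; near=> h.
  have <- : (f \o shift x - (cst (f x) + 'd f x)) h =
     (g \o shift x - (cst (g x) + 'd f x)) h.
    have E : f (h + x) = g (h + x) by near: h.
    by rewrite /= !fctE /= E (nbhs_singleton fg).
  by near: h.
have dg : 'd g x = 'd f x :> (V -> W).
  by apply: diff_unique => //; exact: diff_continuous.
apply/diff_locallyP; rewrite dg; split => //; exact: diff_continuous.
Unshelve. all: by end_near. Qed.

End NearEq.

Section SmoothOn.
Context {R : realType}.
Implicit Types E F : normedModType R.

Lemma smooth_on_differentiable E F (U : set E) (f : E -> F) x :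
  smooth_on U f -> U x -> differentiable f x.
Proof. by move=> sf Ux; exact: (sf [::]). Qed.

Lemma smooth_on_derive E F (U : set E) (f : E -> F) v :
  smooth_on U f -> smooth_on U ('D_v f).
Proof.
move=> sf vs x Ux; have := sf (rcons vs v) x Ux.
by rewrite foldr_rcons.
Qed.

Lemma smooth_on_sub E F (U V : set E) (f : E -> F) :
  V `<=` U -> smooth_on U f -> smooth_on V f.
Proof. by move=> VU sf vs x /VU; exact: sf. Qed.

(** Iterated derivatives never leave the class [P], up to equality on [U], and as [U] is open that
    equality survives further differentiation. Smoothness is thus proved by exhibiting a class of
    differentiable functions stable under derivation, without formulas for higher derivatives. *)
Lemma smooth_on_coind E F (U : set E) (P : (E -> F) -> Prop) :
  open U ->
  (forall f, P f -> forall x, U x -> differentiable f x) ->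
  (forall f v, P f -> exists2 g, P g & forall x, U x -> 'D_v f x = g x) ->
  forall f, P f -> smooth_on U f.
Proof.
move=> oU Pd PD f Pf vs.
suff [g Pg fg] : exists2 g, P g &
    forall x, U x -> foldr (fun v g => 'D_v g) f vs x = g x.
  move=> x Ux; apply: (@near_eq_differentiable _ _ _ g); last exact: Pd.
  have : nbhs x U by exact: open_nbhs_nbhs.
  by apply: filterS => y /fg ->.
elim: vs => [|v vs [g Pg fg]]; first by exists f.
have [h Ph gh] := PD g v Pg; exists h => // x Ux /=.
rewrite -gh//; apply: near_eq_derive.
have : nbhs x U by exact: open_nbhs_nbhs.
by apply: filterS => y /fg ->.
Qed.

Lemma smooth_on_eq E F (U : set E) (f g : E -> F) :
  open U -> (forall x, U x -> f x = g x) -> smooth_on U f -> smooth_on U g.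
Proof.
move=> oU fg sf.
apply: (@smooth_on_coind _ _ _ (fun g => exists2 f, smooth_on U f &
  forall x, U x -> f x = g x)) => //; last by exists f.
  move=> {fg sf} {f}g [f sf fg] x Ux.
  apply: (@near_eq_differentiable _ _ _ f).
    have : nbhs x U by exact: open_nbhs_nbhs.
    by apply: filterS => y /fg.
  exact: smooth_on_differentiable Ux.
move=> {fg sf} {f}g v [f sf fg].
exists ('D_v f).
  by exists ('D_v f) => //; exact: smooth_on_derive.
move=> x Ux; apply: near_eq_derive.
have : nbhs x U by exact: open_nbhs_nbhs.
by apply: filterS => y /fg.
Qed.

End SmoothOn.

Section SmoothAlgebra.
Context {R : realType}.
Implicit Types E F : normedModType R.

Lemma smooth_on_linear E F (G : normedModType R) (U : set E) (f : E -> F)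
    (l : {linear F -> G}) : open U -> continuous l ->
  smooth_on U f -> smooth_on U (l \o f).
Proof.
move=> oU cl sf.
apply: (@smooth_on_coind _ _ _ _ (fun g => exists2 f, smooth_on U f & g = l \o f))
  => //; last by exists f.
  move=> _ [{}f {}sf ->] x Ux; apply: differentiable_comp.
    exact: smooth_on_differentiable Ux.
  exact: linear_differentiable.
move=> _ v [{sf}f sf ->]; exists (l \o 'D_v f).
  by exists ('D_v f) => //; exact: smooth_on_derive.
move=> x Ux; have df := smooth_on_differentiable sf Ux.
have dl : differentiable l (f x) by exact: linear_differentiable.
rewrite deriveE; last exact: differentiable_comp.
by rewrite diff_comp//= diff_lin//= deriveE.
Qed.

Lemma smooth_on_cst E F (U : set E) (a : F) : open U -> smooth_on U (cst a).
Proof.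
move=> oU.
apply: (@smooth_on_coind _ _ _ _ (fun g => exists a, g = cst a)) => //.
- by move=> _ [b ->] x _; exact: differentiable_cst.
- by move=> _ v [b ->]; exists (cst 0); [exists 0|move=> x _; exact: derive_cst].
- by exists a.
Qed.

(** Derivatives of products and inverses are sums of products, so a class such as the products of
    two smooth functions is not stable under derivation; the algebra generated by [G], with
    inverses, is. *)
Inductive generated E (U : set E) (G : (E -> R) -> Prop) : (E -> R) -> Prop :=
| gen_base h : G h -> generated U G h
| gen_add h1 h2 : generated U G h1 -> generated U G h2 ->
    generated U G (fun x => h1 x + h2 x)
| gen_mul h1 h2 : generated U G h1 -> generated U G h2 ->
    generated U G (fun x => h1 x * h2 x)
| gen_inv h : generated U G h -> (forall x, U x -> h x != 0) ->
    generated U G (fun x => (h x)^-1).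

Lemma generated_smooth E (U : set E) (G : (E -> R) -> Prop) : open U ->
  (forall a, G (cst a)) ->
  (forall h, G h -> forall x, U x -> differentiable h x) ->
  (forall h v, G h ->
     exists2 g, generated U G g & forall x, U x -> 'D_v h x = g x) ->
  forall h, generated U G h -> smooth_on U h.
Proof.
move=> oU Gc Gd GD.
have gd h : generated U G h -> forall x, U x -> differentiable h x.
  elim=> {}h.
  - exact: Gd.
  - by move=> h2 _ IH1 _ IH2 x Ux; apply: differentiableD; [exact: IH1|exact: IH2].
  - by move=> h2 _ IH1 _ IH2 x Ux; apply: differentiableM; [exact: IH1|exact: IH2].
  - by move=> _ IH h0 x Ux; apply: differentiableV; [exact: IH|exact: h0].
apply: smooth_on_coind => // h v; elim=> {}h.
- exact: GD.
- move=> h2 g1 [g Gg hg] g2 [k Gk hk]; exists (fun x => g x + k x).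
    exact: gen_add.
  move=> x Ux; rewrite -hg// -hk//.
  by apply: deriveD; apply: diff_derivable; apply: gd.
- move=> h2 g1 [g Gg hg] g2 [k Gk hk].
  exists (fun x => h x * k x + h2 x * g x).
    by apply: gen_add; apply: gen_mul.
  move=> x Ux; rewrite -hg// -hk//.
  by apply: deriveM; apply: diff_derivable; apply: gd.
- move=> Gh [g Gg hg] h0.
  (* The sign in the derivative of an inverse is a constant factor, available because [G] contains
     the constants. *)
  exists (fun x => cst (-1) x * (((h x)^-1 * (h x)^-1) * g x)).
    apply: gen_mul; first exact: gen_base.
    by apply: gen_mul => //; apply: gen_mul; apply: gen_inv.
  move=> x Ux; rewrite -hg// deriveV; last 2 first.
  + exact: h0.
  + by apply: diff_derivable; apply: gd.
  by rewrite /= mulN1r -exprVn expr2 /GRing.scale/= mulNr.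
Qed.

Lemma smooth_generated E (U : set E) h :
  open U -> generated U (@smooth_on R E R U) h -> smooth_on U h.
Proof.
move=> oU; apply: generated_smooth => //.
- by move=> a; exact: smooth_on_cst.
- by move=> k sk x Ux; exact: smooth_on_differentiable Ux.
- move=> k v sk; exists ('D_v k) => //; apply: gen_base.
  exact: smooth_on_derive.
Qed.

Lemma smooth_onD E (U : set E) (f g : E -> R) : open U ->
  smooth_on U f -> smooth_on U g -> smooth_on U (fun x => f x + g x).
Proof.
by move=> oU sf sg; apply: smooth_generated => //; apply: gen_add; apply: gen_base.
Qed.

Lemma smooth_onM E (U : set E) (f g : E -> R) : open U ->
  smooth_on U f -> smooth_on U g -> smooth_on U (fun x => f x * g x).
Proof.
by move=> oU sf sg; apply: smooth_generated => //; apply: gen_mul; apply: gen_base.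
Qed.

Lemma smooth_onV E (U : set E) (f : E -> R) : open U ->
  smooth_on U f -> (forall x, U x -> f x != 0) -> smooth_on U (fun x => (f x)^-1).
Proof.
by move=> oU sf f0; apply: smooth_generated => //; apply: gen_inv => //; exact: gen_base.
Qed.

Lemma smooth_on_sum E (U : set E) (I : Type) (s : seq I) (P : pred I) (f : I -> E -> R) :
  open U -> (forall i, smooth_on U (f i)) ->
  smooth_on U (fun x => \sum_(i <- s | P i) f i x).
Proof.
move=> oU sf; elim: s => [|i s IH].
  by under eq_fun do rewrite big_nil; exact: smooth_on_cst.
under eq_fun do rewrite big_cons.
by case: (P i) => //; exact: smooth_onD.
Qed.

Lemma smooth_on_prod E (U : set E) (I : Type) (s : seq I) (P : pred I) (f : I -> E -> R) :
  open U -> (forall i, smooth_on U (f i)) ->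
  smooth_on U (fun x => \prod_(i <- s | P i) f i x).
Proof.
move=> oU sf; elim: s => [|i s IH].
  by under eq_fun do rewrite big_nil; exact: smooth_on_cst.
under eq_fun do rewrite big_cons.
by case: (P i) => //; exact: smooth_onM.
Qed.

(** By the chain rule a derivative of [k \o f] is the sum over [i] of [c i ('D_v f x)] times
    ['D_(e i) k (f x)]. Hence the algebra generated by the functions smooth on [U] and by the
    [k \o f], with [k] smooth on [V], is stable under derivation. *)
Lemma smooth_on_comp E F (I : finType) (e : I -> F) (c : I -> {linear F -> R})
    (U : set E) (V : set F) (f : E -> F) (h : F -> R) :
  (forall i, continuous (c i)) -> (forall w, w = \sum_i c i w *: e i) ->
  open U -> (forall x, U x -> V (f x)) ->
  smooth_on U f -> smooth_on V h -> smooth_on U (h \o f).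
Proof.
move=> cc ce oU UV sf sh.
pose G (k : E -> R) := smooth_on U k \/ exists2 h, smooth_on V h & k = h \o f.
apply: (@generated_smooth _ _ G) => //; last by apply: gen_base; right; exists h.
- by move=> a; left; exact: smooth_on_cst.
- move=> k [sk|[{}k sk ->]] x Ux; first exact: smooth_on_differentiable Ux.
  apply: differentiable_comp; first exact: smooth_on_differentiable Ux.
  by apply: (smooth_on_differentiable sk); exact: UV.
- move=> k v [sk|[{}k sk ->]].
    by exists ('D_v k) => //; apply: gen_base; left; exact: smooth_on_derive.
  exists (fun x => \sum_i (c i ('D_v f x) * 'D_(e i) k (f x))).
    elim: (index_enum I) => [|i s IH].
      under eq_fun do rewrite big_nil.
      by apply: gen_base; left; exact: smooth_on_cst.
    under eq_fun do rewrite big_cons.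
    apply: gen_add => //; apply: gen_mul; apply: gen_base; [left|right].
      apply: (@smooth_on_linear _ _ _ _ ('D_v f)) => //.
      exact: smooth_on_derive.
    by exists ('D_(e i) k) => //; exact: smooth_on_derive.
  move=> x Ux; have df := smooth_on_differentiable sf Ux.
  have dk := smooth_on_differentiable sk (UV _ Ux).
  rewrite deriveE; last exact: differentiable_comp.
  rewrite diff_comp//= -(deriveE v df) [X in 'd k _ X]ce linear_sum.
  by apply: eq_bigr => i _; rewrite linearZ/= -deriveE.
Qed.

End SmoothAlgebra.

Definition mx_entry (R : realType) m n (i : 'I_m) (j : 'I_n) (A : 'M[R]_(m, n)) : R :=
  A i j.

Fact mx_entry_is_linear (R : realType) m n (i : 'I_m) (j : 'I_n) :
  linear (@mx_entry R m n i j : 'M[R]_(m, n) -> R).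
Proof. by move=> a A B; rewrite /mx_entry !mxE. Qed.

HB.instance Definition _ (R : realType) m n (i : 'I_m) (j : 'I_n) :=
  GRing.isLinear.Build R 'M[R]_(m, n) R _ (@mx_entry R m n i j)
    (@mx_entry_is_linear R m n i j).

(** Finite dimension in a form that covers R, matrices and their products at once. *)
Record coordinates (R : realType) (F : normedModType R) := Coordinates {
  coord_idx : finType;
  coord_vec : coord_idx -> F;
  coord_form : coord_idx -> {linear F -> R};
  coord_form_continuous : forall i, continuous (coord_form i);
  coord_dec : forall w, w = \sum_i coord_form i w *: coord_vec i
}.

Section Coordinates.
Context {R : realType}.
Implicit Types E F G : normedModType R.

Definition coordR : coordinates R.
Proof.
refine (@Coordinates R R 'I_1 (fun=> 1) (fun=> (@idfun R : {linear R -> R})) _ _).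
  by move=> _ x; exact: cvg_id.
by move=> w; rewrite big_ord1 /= [_ *: _]mulr1.
Defined.

Definition coord_mx m n : coordinates 'M[R]_(m, n).
Proof.
apply: (@Coordinates _ _ ('I_m * 'I_n)%type (fun ij => delta_mx ij.1 ij.2)
  (fun ij => @mx_entry R m n ij.1 ij.2)) => [ij|w].
  exact: coord_continuous.
by rewrite {1}[w]matrix_sum_delta pair_bigA.
Defined.

Definition coord_pair F G (a : coordinates F) (b : coordinates G) :
  coordinates (F * G)%type.
Proof.
apply: (@Coordinates _ _ (coord_idx a + coord_idx b)%type
  (fun i => match i with inl i => (coord_vec i, 0) | inr i => (0, coord_vec i) end)
  (fun i => match i with inl i => coord_form i \o fst
                       | inr i => coord_form i \o snd end)) => [[i|i] z|[u v]] /=.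
- by apply: continuous_comp; [exact: cvg_fst|exact: coord_form_continuous].
- by apply: continuous_comp; [exact: cvg_snd|exact: coord_form_continuous].
rewrite big_sumType /=.
have pD (x y : F) (z t : G) : (x, z) + (y, t) = (x + y, z + t) by [].
have E1 (P : coord_idx a -> F) : \sum_i (P i, 0 : G) = (\sum_i P i, 0).
  by elim: (index_enum _) => [|i s IH]; rewrite ?big_nil// !big_cons IH pD addr0.
have E2 (P : coord_idx b -> G) : \sum_i (0 : F, P i) = (0, \sum_i P i).
  by elim: (index_enum _) => [|i s IH]; rewrite ?big_nil// !big_cons IH pD addr0.
have S1 i : @coord_form _ _ a i u *: (coord_vec i, 0 : G) =
    (coord_form i u *: coord_vec i, 0).
  by congr pair; rewrite scaler0.
have S2 i : @coord_form _ _ b i v *: (0 : F, coord_vec i) =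
    (0, coord_form i v *: coord_vec i).
  by congr pair; rewrite scaler0.
under eq_bigr do rewrite S1; under [X in _ + X]eq_bigr do rewrite S2.
by rewrite E1 E2 -!coord_dec pD addr0 add0r.
Defined.

Lemma smooth_on_coord E F (a : coordinates F) (U : set E) (f : E -> F) : open U ->
  (forall i, smooth_on U (@coord_form _ _ a i \o f)) -> smooth_on U f.
Proof.
move=> oU; move: f.
have dd f : (forall i x, U x -> differentiable (@coord_form _ _ a i \o f) x) ->
    forall x, U x -> differentiable f x /\
    forall v, 'D_v f x = \sum_i 'D_v (@coord_form _ _ a i \o f) x *: coord_vec i.
  move=> df x Ux.
  have fE : (fun y => \sum_i (@coord_form _ _ a i \o f) y *: coord_vec i) = f.
    by apply/funext => y; rewrite [RHS](coord_dec a (f y)).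
  have /all_and2[] : forall s : seq (coord_idx a),
    differentiable (fun y => \sum_(i <- s)
        (@coord_form _ _ a i \o f) y *: coord_vec i) x /\
    forall v, 'D_v (fun y => \sum_(i <- s)
        (@coord_form _ _ a i \o f) y *: coord_vec i) x =
       \sum_(i <- s) 'D_v (@coord_form _ _ a i \o f) x *: coord_vec i.
    elim=> [|i s [IH1 IH2]].
      split => [|v]; under eq_fun do rewrite big_nil; first exact: differentiable_cst.
      by rewrite big_nil; exact: derive_cst.
    have di := df i x Ux.
    have dz : differentiable (fun y => (coord_form i \o f) y *: coord_vec i) x.
      exact: differentiableZl.
    split => [|v]; under eq_fun do rewrite big_cons; first exact: differentiableD.
    rewrite big_cons deriveD ?IH2; try exact: diff_derivable.
    by congr (_ + _); rewrite deriveE// diffZl// -deriveE.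
  by move=> /(_ (index_enum _)) + /(_ (index_enum _)); rewrite fE.
apply: (@smooth_on_coind _ _ _ _ (fun f => forall i, smooth_on U (coord_form i \o f)))
  => // [f sf x Ux|f v sf].
  by have [] := dd f (fun i y Uy => smooth_on_differentiable (sf i) Uy) x Ux.
exists ('D_v f) => // i.
have df x : U x -> differentiable f x.
  by move=> Ux; have [] := dd f (fun i y Uy => smooth_on_differentiable (sf i) Uy) x Ux.
apply: smooth_on_eq (smooth_on_derive v (sf i)) => // x Ux.
have dl : differentiable (@coord_form _ _ a i) (f x).
  by apply: linear_differentiable; exact: coord_form_continuous.
have dfx := df _ Ux.
rewrite deriveE; last exact: differentiable_comp.
rewrite diff_comp//= diff_lin//= ?deriveE//.
exact: coord_form_continuous.
Qed.

Lemma smooth_on_compose E F G (a : coordinates F) (b : coordinates G)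
    (U : set E) (V : set F) (f : E -> F) (h : F -> G) :
  open U -> open V -> (forall x, U x -> V (f x)) ->
  smooth_on U f -> smooth_on V h -> smooth_on U (h \o f).
Proof.
move=> oU oV UV sf sh; apply: (smooth_on_coord (a := b)) => // i.
have si : smooth_on V (@coord_form _ _ b i \o h).
  by apply: smooth_on_linear => //; exact: coord_form_continuous.
exact: (smooth_on_comp (@coord_form_continuous _ _ a) (@coord_dec _ _ a) oU UV sf si).
Qed.

Lemma smooth_on_pair E F G (U : set E) (f : E -> F) (g : E -> G) : open U ->
  smooth_on U f -> smooth_on U g -> smooth_on U (fun x => (f x, g x)).
Proof.
move=> oU sf sg.
apply: (@smooth_on_coind _ _ _ _ (fun h => exists f g,
  [/\ smooth_on U f, smooth_on U g & h = fun x => (f x, g x)])) => //;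
      last by exists f, g.
  move=> _ [{}f [{}g [{}sf {}sg ->]]] x Ux.
  by apply: differentiable_pair; apply: smooth_on_differentiable Ux.
move=> _ v [{}f [{}g [{}sf {}sg ->]]].
exists (fun x => ('D_v f x, 'D_v g x)).
  by exists ('D_v f), ('D_v g); split=> //; exact: smooth_on_derive.
move=> x Ux.
have df := smooth_on_differentiable sf Ux; have dg := smooth_on_differentiable sg Ux.
by rewrite deriveE; [rewrite diff_pair//= -!deriveE|exact: differentiable_pair].
Qed.

Lemma smooth_on_id E (U : set E) : open U -> smooth_on U (@idfun E).
Proof.
move=> oU.
apply: (@smooth_on_coind _ _ _ _ (fun h => h = idfun \/ exists a, h = cst a)) => //.
- by move=> _ [->|[b ->]] x _; [exact: ex_diff|exact: differentiable_cst].
- move=> _ v [->|[b ->]].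
    by exists (cst v); [right; exists v|move=> x _; exact: derive_id].
  by exists (cst 0); [right; exists 0|move=> x _; exact: derive_cst].
- by left.
Qed.

Lemma smooth_on_fst E F (U : set (E * F)) :
  open U -> smooth_on U (@fst E F).
Proof.
move=> oU; have c1 : continuous (@fst E F : {linear (E * F)%type -> E}).
  by move=> z; exact: cvg_fst.
exact: (smooth_on_linear oU c1 (smooth_on_id oU)).
Qed.

Lemma smooth_on_snd E F (U : set (E * F)) :
  open U -> smooth_on U (@snd E F).
Proof.
move=> oU; have c2 : continuous (@snd E F : {linear (E * F)%type -> F}).
  by move=> z; exact: cvg_snd.
exact: (smooth_on_linear oU c2 (smooth_on_id oU)).
Qed.

End Coordinates.

Section SmoothMatrix.
Context {R : realType} {E : normedModType R} (U : set E).
Hypothesis oU : open U.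

Lemma smooth_on_entry m n (f : E -> 'M[R]_(m, n)) i j :
  smooth_on U f -> smooth_on U (fun x => f x i j).
Proof.
move=> sf; apply: (@smooth_on_linear _ _ _ _ U f (@mx_entry R m n i j)) => //.
exact: coord_continuous.
Qed.

Lemma smooth_on_mx m n (f : E -> 'M[R]_(m, n)) :
  (forall i j, smooth_on U (fun x => f x i j)) -> smooth_on U f.
Proof.
move=> sf; apply: (smooth_on_coord (a := coord_mx m n)) => // -[i j].
exact: sf.
Qed.

Lemma smooth_on_mulmx m n p (f : E -> 'M[R]_(m, n)) (g : E -> 'M[R]_(n, p)) :
  smooth_on U f -> smooth_on U g -> smooth_on U (fun x => f x *m g x).
Proof.
move=> sf sg; apply: smooth_on_mx => i j; under eq_fun do rewrite mxE.
by apply: smooth_on_sum => // l; apply: smooth_onM => //; exact: smooth_on_entry.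
Qed.

Lemma smooth_on_trmx m n (f : E -> 'M[R]_(m, n)) :
  smooth_on U f -> smooth_on U (fun x => (f x)^T).
Proof.
move=> sf; apply: smooth_on_mx => i j; under eq_fun do rewrite mxE.
exact: smooth_on_entry.
Qed.

Lemma smooth_on_addmx m n (f g : E -> 'M[R]_(m, n)) :
  smooth_on U f -> smooth_on U g -> smooth_on U (fun x => f x + g x).
Proof.
move=> sf sg; apply: smooth_on_mx => i j; under eq_fun do rewrite mxE.
by apply: smooth_onD => //; exact: smooth_on_entry.
Qed.

Lemma smooth_on_scalemx m n (c : E -> R) (f : E -> 'M[R]_(m, n)) :
  smooth_on U c -> smooth_on U f -> smooth_on U (fun x => c x *: f x).
Proof.
move=> sc sf; apply: smooth_on_mx => i j; under eq_fun do rewrite mxE.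
by apply: smooth_onM => //; exact: smooth_on_entry.
Qed.

Lemma smooth_on_det n (f : E -> 'M[R]_n) :
  smooth_on U f -> smooth_on U (fun x => \det (f x)).
Proof.
move=> sf; apply: smooth_on_sum => // s.
apply: smooth_onM => //; first exact: (smooth_on_cst _ oU).
by apply: smooth_on_prod => // i; exact: smooth_on_entry.
Qed.

Lemma smooth_on_invmx n (f : E -> 'M[R]_n) :
  smooth_on U f -> (forall x, U x -> f x \in unitmx) ->
  smooth_on U (fun x => invmx (f x)).
Proof.
move=> sf uf.
apply: (@smooth_on_eq _ _ _ _ (fun x => (\det (f x))^-1 *: \adj (f x))) => //.
  by move=> x Ux; rewrite /invmx uf.
apply: smooth_on_scalemx.
  apply: smooth_onV => //; first exact: smooth_on_det.
  by move=> x Ux; have := uf x Ux; rewrite unitmxE unitfE.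
apply: smooth_on_mx => i j; under eq_fun do rewrite mxE.
apply: smooth_onM => //; first exact: (smooth_on_cst _ oU).
apply: smooth_on_det; apply: smooth_on_mx => k l; under eq_fun do rewrite !mxE.
exact: smooth_on_entry.
Qed.

End SmoothMatrix.

(** * Strict differentiability *)

Section RealAnalysis.
Context {R : realType}.

Lemma ler_mx_norm m n (A : 'M[R]_(m, n)) e : 0 <= e ->
  (forall i j, `|A i j| <= e) -> `|A| <= e.
Proof.
move=> e0 Ae; rewrite /Num.Def.normr/= mx_normrE.
by apply: bigmax_le => // -[i j] _ /=.
Qed.

Lemma mx_norm_ge_entry m n (A : 'M[R]_(m, n)) i j : `|A i j| <= `|A|.
Proof.
rewrite [leRHS]/Num.Def.normr/= mx_normrE.
exact: (@le_bigmax _ _ _ _ (fun ij => `|A ij.1 ij.2|) (i, j)).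
Qed.

Lemma is_derive_mxP (V : normedModType R) m n (f : V -> 'M[R]_(m, n)) x v A :
  is_derive x v f A <-> forall i j, is_derive x v (fun y => f y i j) (A i j).
Proof.
split=> [[df <-] i j|df].
  split; first exact: (derivable_mxP _ _ _).1.
  by rewrite derive_mx// mxE.
have dd : derivable f x v by apply/derivable_mxP => i j; have [] := df i j.
split=> //; rewrite derive_mx//; apply/matrixP => i j; rewrite mxE.
by have [] := df i j.
Qed.

Lemma is_derive_continuous (f : R -> R) (x d : R) :
  is_derive x 1 f d -> {for x, continuous f}.
Proof.
by move=> [df _]; apply: differentiable_continuous; apply/derivable1_diffP.
Qed.

(** The interval shrinks because [g] may be unbounded near [a] and [b]; on a compact segment inside
    it is integrable. *)
Lemma antiderivative (g : R -> R) (a b a' b' : R) :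
  (forall t, a < t < b -> {for t, continuous g}) -> a < a' -> b' < b ->
  exists F : R -> R, forall t, a' < t < b' -> is_derive t 1 F (g t).
Proof.
move=> cg aa' b'b.
exists (fun x => \int[lebesgue_measure]_(t in [set` `[a', x]]) (g t))%R.
move=> t /andP[a't tb'].
have [|//|d1 d2] := continuous_FTC1_closed tb' _ a't (cg t _).
- apply: continuous_compact_integrable; first exact: segment_compact.
  apply: continuous_in_subspaceT => x; rewrite inE/= in_itv/= => /andP[ax xb].
  by apply: cg; rewrite (lt_le_trans aa' ax) (le_lt_trans xb b'b).
- by rewrite (lt_trans aa' a't) (lt_trans tb' b'b).
by split; [exact: d1|rewrite -derive1E; exact: d2].
Qed.

Lemma antiderivative_mx m n (g : R -> 'M[R]_(m, n)) (a b a' b' : R) :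
  (forall t, a < t < b -> {for t, continuous g}) -> a < a' -> b' < b ->
  exists F : R -> 'M[R]_(m, n), forall t, a' < t < b' -> is_derive t 1 F (g t).
Proof.
move=> cg aa' b'b.
have /choice[F HF] : forall ij : 'I_m * 'I_n, exists F : R -> R,
    forall t, a' < t < b' -> is_derive t 1 F (g t ij.1 ij.2).
  move=> [i j]; apply: antiderivative aa' b'b => t tab.
  by apply: (@continuous_comp _ _ _ g (fun A : 'M[R]_(m, n) => A i j));
      [exact: cg|exact: coord_continuous].
exists (fun t => \matrix_(i, j) F (i, j) t) => t tab.
apply: (iffRL (is_derive_mxP _ _ _ _)) => i j.
by under eq_fun do rewrite mxE; exact: (HF (i, j)).
Qed.

Lemma mean_value_le (F dF : R -> R) (a b M : R) : a <= b ->
  (forall t, a <= t <= b -> is_derive t 1 F (dF t)) ->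
  (forall t, a <= t <= b -> `|dF t| <= M) -> `|F b - F a| <= M * (b - a).
Proof.
move=> ab dFab leM.
have [| |c] := @MVT_segment R F dF a b ab.
- move=> t; rewrite in_itv/= => /andP[at_ tb]; apply: dFab.
  by rewrite (ltW at_) (ltW tb).
- apply: continuous_in_subspaceT => x; rewrite inE/= in_itv/= => xab.
  exact: is_derive_continuous (dFab _ xab).
rewrite in_itv/= => cab ->.
rewrite normrM (ger0_norm (x := b - a)) ?subr_ge0//.
by rewrite ler_wpM2r ?subr_ge0// leM.
Qed.

Lemma mean_value_lipschitz (F dF : R -> R) (a b M : R) :
  (forall t, a < t < b -> is_derive t 1 F (dF t)) ->
  (forall t, a < t < b -> `|dF t| <= M) ->
  forall s t, a < s < b -> a < t < b -> `|F s - F t| <= M * `|s - t|.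
Proof.
move=> dFab leM s t sab tab.
wlog ts : s t sab tab / t <= s.
  move=> W; have [ts|/ltW st] := leP t s; first exact: W.
  by rewrite distrC (distrC s); exact: W.
rewrite (ger0_norm (x := s - t)) ?subr_ge0//.
have sub x : t <= x <= s -> a < x < b.
  move: sab tab => /andP[? ?] /andP[? ?] /andP[? ?].
  by apply/andP; split; [exact: (@lt_le_trans _ _ t)|exact: (@le_lt_trans _ _ s)].
by apply: mean_value_le => // x /sub; [exact: dFab|exact: leM].
Qed.

Lemma is_derive_0_const_itv m n (F : R -> 'M[R]_(m, n)) (a b : R) :
  (forall t, a < t < b -> is_derive t 1 F 0) ->
  forall s t, a < s < b -> a < t < b -> F s = F t.
Proof.
move=> dF s t sab tab; apply/matrixP => i j.
apply/eqP; rewrite -subr_eq0 -normr_le0.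
have := @mean_value_lipschitz (fun t => F t i j) (fun=> 0) a b 0 _ _ s t sab tab.
rewrite mul0r; apply => // x xab; last by rewrite normr0.
by have /is_derive_mxP/(_ i j) := dF x xab; rewrite mxE.
Qed.

(* Strictness (both end points vary) is what the contraction argument of
   [strict_paths_generate] needs. *)
Definition strict_derive (V : normedModType R) (h : R -> V) (t0 : R) (v : V) :=
  forall e : R, 0 < e -> exists2 d, 0 < d & forall s t : R,
    `|s - t0| < d -> `|t - t0| < d -> `|h s - h t - (s - t) *: v| <= e * `|s - t|.

End RealAnalysis.

Section StrictDerive.
Context {R : realType}.

Lemma finite_common_radius (I : finType) (P : I -> R -> Prop) :
  (forall i, exists2 d, 0 < d & P i d) ->
  (forall i d d', d' <= d -> P i d -> P i d') ->
  exists2 d, 0 < d & forall i, P i d.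
Proof.
move=> ex Pmon.
have /choice[d Hd] : forall i, exists d, 0 < d /\ P i d.
  by move=> i; have [d ? ?] := ex i; exists d.
exists (\big[Num.min/1]_i d i).
  by apply: lt_bigmin => // i _; exact: (Hd i).1.
by move=> i; apply: Pmon (Hd i).2; apply: bigmin_le_cond.
Qed.

Lemma mulmx_norm_le m n p (A : 'M[R]_(m, n)) (B : 'M[R]_(n, p)) :
  `|A *m B| <= n%:R * `|B| * `|A|.
Proof.
apply: ler_mx_norm => [|i j]; first by rewrite !mulr_ge0.
rewrite mxE (le_trans (ler_norm_sum _ _ _))//.
rewrite -mulrA mulr_natl -[X in _ *+ X](card_ord n) -sumr_const.
apply: ler_sum => l _; rewrite normrM mulrC.
by apply: ler_pM => //; exact: mx_norm_ge_entry.
Qed.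

Lemma strict_derive_mxP m n (h : R -> 'M[R]_(m, n)) t0 (v : 'M[R]_(m, n)) :
  (forall i j, strict_derive (fun t => h t i j) t0 (v i j : R)) ->
  strict_derive h t0 v.
Proof.
move=> sh e e0.
have [|ij d d' d'd Pd s t sd td|d d0 Hd] :=
  @finite_common_radius ('I_m * 'I_n)%type (fun ij d =>
  forall s t : R, `|s - t0| < d -> `|t - t0| < d ->
   `|h s ij.1 ij.2 - h t ij.1 ij.2 - (s - t) * v ij.1 ij.2| <= e * `|s - t|).
- by move=> [i j]; exact: sh.
- by apply: Pd; [exact: lt_le_trans d'd|exact: lt_le_trans d'd].
exists d => // s t sd td; apply: ler_mx_norm => [|i j].
  by rewrite mulr_ge0// ltW.
by have := Hd (i, j) s t sd td; rewrite !mxE.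
Qed.

Lemma strict_deriveD (V : normedModType R) (h1 h2 : R -> V) t0 v1 v2 :
  strict_derive h1 t0 v1 -> strict_derive h2 t0 v2 ->
  strict_derive (fun t => h1 t + h2 t) t0 (v1 + v2).
Proof.
move=> s1 s2 e e0; have e20 : 0 < e / 2 by rewrite divr_gt0.
have [d1 d10 H1] := s1 _ e20; have [d2 d20 H2] := s2 _ e20.
exists (Num.min d1 d2) => [|s t]; first by rewrite lt_min d10.
rewrite !lt_min => /andP[sd1 sd2] /andP[td1 td2].
rewrite scalerDr !opprD [X in `|X + _|]addrACA [X in `|X|]addrACA.
by rewrite (le_trans (ler_normD _ _))// [e]splitr mulrDl lerD//; [exact: H1|exact: H2].
Qed.

Lemma strict_deriveN (V : normedModType R) (h : R -> V) t0 v :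
  strict_derive h t0 v -> strict_derive (fun t => - h t) t0 (- v).
Proof.
move=> sh e e0; have [d d0 Hd] := sh e e0; exists d => // s t sd td.
have -> : - h s - - h t - (s - t) *: - v = - (h s - h t - (s - t) *: v).
  by rewrite scalerN !opprD.
by rewrite normrN; exact: Hd.
Qed.

Lemma strict_derive_mulmx m n p (h : R -> 'M[R]_(m, n)) t0 v (B : 'M[R]_(n, p)) :
  strict_derive h t0 v -> strict_derive (fun t => h t *m B) t0 (v *m B).
Proof.
move=> sh e e0; pose C := n%:R * `|B| + 1.
have C0 : 0 < C by rewrite ltr_wpDl// mulr_ge0.
have [d d0 Hd] := sh (e / C) (divr_gt0 e0 C0).
exists d => // s t sd td.
rewrite scalemxAl -!mulmxBl (le_trans (mulmx_norm_le _ _))//.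
have := Hd s t sd td; rewrite mulrAC ler_pdivlMr// mulrC => /(le_trans _); apply.
by rewrite ler_wpM2r// lerDl.
Qed.

Lemma strict_deriveZ (V : normedModType R) (h : R -> V) (a : R) v :
  strict_derive h 0 v -> strict_derive (fun t => h (a * t)) 0 (a *: v).
Proof.
move=> sh e e0; have a0 : 0 < `|a| + 1 by rewrite ltr_wpDl.
have [d d0 Hd] := sh (e / (`|a| + 1)) (divr_gt0 e0 a0).
have aux x : `|x| < d / (`|a| + 1) -> `|a * x - 0| < d.
  rewrite ltr_pdivlMr// subr0; apply: le_lt_trans.
  by rewrite normrM mulrC ler_wpM2l// lerDl.
exists (d / (`|a| + 1)) => [|s t]; first by rewrite divr_gt0.
rewrite !subr0 => sd td.
have := Hd _ _ (aux _ sd) (aux _ td).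
rewrite -mulrBr [a * (s - t)]mulrC -scalerA => /le_trans; apply.
rewrite normrM mulrAC -mulrA ler_wpM2l ?(ltW e0)// -mulrA ler_piMr//.
by rewrite ler_pdivrMr// mul1r lerDl.
Qed.

Lemma strict_derive_shift (V : normedModType R) (h : R -> V) t0 v c :
  strict_derive h t0 v -> strict_derive (fun t => h (t0 + t) + c) 0 v.
Proof.
move=> sh e e0; have [d d0 Hd] := sh e e0; exists d => // s t.
rewrite !subr0 => sd td.
have E (W : zmodType) (x y z : W) : z + x - (z + y) = x - y.
  by rewrite opprD addrACA subrr add0r.
have := Hd (t0 + s) (t0 + t).
rewrite ![t0 + _ - t0]addrAC subrr !add0r E => /(_ sd td).
by rewrite [h (t0 + s) + c]addrC [h (t0 + t) + c]addrC E.
Qed.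

Lemma strict_derive_is_derive (V : normedModType R) (h : R -> V) (t : R) v :
  strict_derive h t v -> is_derive t 1 h v.
Proof.
move=> sh.
have lim : h0^-1 *: ((h \o shift t) (h0 *: 1) - h t) @[h0 --> 0^'] --> v.
  apply/cvgrPdist_le => e e0; have [d d0 Hd] := sh e e0.
  near=> x.
  have x0 : x != 0 by near: x; exact: nbhs_dnbhs_neq.
  have xd : `|x| < d by near: x; exact: dnbhs0_lt.
  have := Hd (x + t) t; rewrite addrK subrr normr0 => /(_ xd d0) H.
  rewrite /= [x *: 1]mulr1 -[v in `|v - _|](scalerK x0) -scalerBr.
  by rewrite normrZ normfV distrC mulrC ler_pdivrMr// normr_gt0.
split; first by apply/cvg_ex; exists v.
exact: cvg_lim lim.
Unshelve. all: by end_near. Qed.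

End StrictDerive.

(** * Differentiation under the integral sign, with strict derivatives *)

Section ParameterIntegral.
Context {R : realType}.

(** Compactness of the segment gives one [d] for all [t]. *)
Lemma uniform_near_segment (G : R * R -> R) (r0 e : R) : 0 < e ->
  (forall t, 0 <= t <= 1 -> {for (t, r0), continuous G}) ->
  exists2 d, 0 < d & forall t r, 0 <= t <= 1 -> `|r - r0| < d ->
    `|G (t, r) - G (t, r0)| <= e.
Proof.
move=> e0 cG; have e20 : 0 < e / 2 by rewrite divr_gt0.
have /compact_near_coveringP cov := @segment_compact R 0 1.
have [|d /= d0 Hd] := cov R (nbhs r0) (fun r t => `|G (t, r) - G (t, r0)| <= e) _.
  move=> t /=; rewrite in_itv/= => t01.
  have /cvgrPdist_lt/(_ _ e20) [[A B] /= [tA rB] AB] := cG t t01.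
  exists (A, B) => //= -[t' r] /= [At' Br].
  have H1 := AB (t', r) (conj At' Br).
  have H2 := AB (t', r0) (conj At' (nbhs_singleton rB)).
  rewrite -(subrKA (G (t, r0))) (le_trans (ler_normD _ _))// [e]splitr.
  by rewrite lerD// ltW// distrC.
exists d => // t r t01 rd; apply: (Hd r) => /=; last by rewrite in_itv.
by rewrite distrC.
Qed.

(** Primitives stand in for the integrals, so two mean value estimates suffice: one in [r] bounds
    [G t s - G t s' - (s - s') * G2 t r0], the other in [t] carries this bound over [0, 1]. *)
Lemma strict_derive_parameter_integral (G G2 Th : R -> R -> R) (W : R -> R)
    (a b r0 : R) : a < r0 < b ->
  (forall t r : R, 0 <= t <= 1 -> a < r < b -> is_derive r 1 (G t) (G2 t r)) ->
  (forall t, 0 <= t <= 1 ->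
     {for (t, r0), continuous (fun p : R * R => G2 p.1 p.2)}) ->
  (forall r t : R, a < r < b -> 0 <= t <= 1 -> is_derive t 1 (Th r) (G t r)) ->
  (forall t : R, 0 <= t <= 1 -> is_derive t 1 W (G2 t r0)) ->
  strict_derive (fun r => Th r 1 - Th r 0) r0 (W 1 - W 0).
Proof.
move=> /andP[ar0 r0b] dG cG2 dTh dW e e0.
have [d d0 Hd] := uniform_near_segment e0 cG2.
pose d' := Num.min d (Num.min (r0 - a) (b - r0)).
have sub r : r0 - d' < r < r0 + d' -> a < r < b /\ `|r - r0| < d.
  move=> /andP[r1 r2]; have : `|r - r0| < d'.
    by rewrite ltr_norml; apply/andP; split; lra.
  rewrite !lt_min => /and3P[rd ra rb]; split=> //.
  by move: ra rb; rewrite !ltr_norml => /andP[? ?] /andP[? ?]; apply/andP; split; lra.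
exists d' => [|s s' sd sd']; first by rewrite !lt_min d0 !subr_gt0 ar0.
have ball_sub r : `|r - r0| < d' -> r0 - d' < r < r0 + d'.
  by rewrite ltr_norml => /andP[? ?]; apply/andP; split; lra.
pose D t := Th s t - Th s' t - (s - s') * W t.
have -> : Th s 1 - Th s 0 - (Th s' 1 - Th s' 0) - (s - s') *: (W 1 - W 0) = D 1 - D 0.
  by rewrite /D /GRing.scale/=; ring.
rewrite -[leRHS]mulr1 -[X in _ <= _ * X](subr0 1).
apply: (@mean_value_le _ D (fun t => G t s - G t s' - (s - s') * G2 t r0)) => // t t01.
  have ds := dTh s t (sub _ (ball_sub _ sd)).1 t01.
  have ds' := dTh s' t (sub _ (ball_sub _ sd')).1 t01.
  have dw := dW t t01.
  by apply: is_deriveB; apply: is_deriveZ.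
have -> : G t s - G t s' - (s - s') * G2 t r0 =
    (G t s - s * G2 t r0) - (G t s' - s' * G2 t r0) by ring.
apply: (@mean_value_lipschitz _ (fun r => G t r - r * G2 t r0)
  (fun r => G2 t r - G2 t r0) (r0 - d') (r0 + d')) => [r rr|r rr||]; last 2 first.
- exact: ball_sub.
- exact: ball_sub.
- have dr := dG t r t01 (sub r rr).1.
  apply: is_deriveB.
  have := is_deriveM (is_derive_id r 1) (is_derive_cst (G2 t r0) r 1).
  rewrite /= scaler0 add0r [_ *: 1]mulr1; exact.
- exact: Hd t01 (sub r rr).2.
Qed.

End ParameterIntegral.

(** * Contractions, and subgroups that fill R^k *)

HB.instance Definition _ (R : realType) (m n : nat) :=
  Uniform_isComplete.Build 'M[R]_(m, n) cauchy_cvg.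

Section LocalSurjectivity.
Context {R : realType} {k : nat}.

Lemma closed_ball_fixpoint (V : completeNormedModType R) (T : V -> V) (rho : R) :
  0 < rho ->
  (forall x, `|x| <= rho -> `|T x| <= rho) ->
  (forall x y, `|x| <= rho -> `|y| <= rho -> `|T x - T y| <= 2^-1 * `|x - y|) ->
  exists2 x, `|x| <= rho & T x = x.
Proof.
move=> rho0 Tr TL.
pose U : set V := [set x | `|x| <= rho].
have TU : set_fun U U T by move=> x; exact: Tr.
have h0 : 0 <= (2^-1 : R) by rewrite invr_ge0.
have [||| x Ux xT] := @banach_fixed_point R V U (mkfun_fun TU).
- exists (NngNum h0); split => /=; first by rewrite invf_lt1// ltr1n.
  by move=> [x y] /= [Ux Uy]; exact: TL.
- rewrite (_ : U = (fun x => `|x|) @^-1` [set r | r <= rho])//.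
  by apply: closed_comp => [x _|]; [exact: norm_continuous|exact: closed_le].
- by exists 0; rewrite /U/= normr0 ltW.
by exists x => //; exact/esym.
Qed.

(** The map [Phi], the sum of the [h i] at the coordinates of [t], is a small Lipschitz perturbation
    of the identity. For small [y] the map sending [s] to [s - Phi s + y] therefore contracts a
    ball, and its fixed point solves [Phi s = y]. As [Phi] takes its values in [H], a ball around 0
    lies in [H], and multiples of its vectors fill the space. *)
Lemma strict_paths_generate (H : set 'rV[R]_k) (h : 'I_k -> R -> 'rV[R]_k) :
  H 0 -> (forall x y, H x -> H y -> H (x + y)) ->
  (forall i, h i 0 = 0) ->
  (forall i, strict_derive (h i) 0 (delta_mx 0 i)) ->
  (forall i, exists2 d, 0 < d & forall t : R, `|t| < d -> H (h i t)) ->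
  H = setT.
Proof.
move=> H0 HD h0 hs hH.
(* Each of the [k] coordinates contributes this slope, at most 1/2 in total; [k.+1] covers the case
   [k = 0]. *)
have e0 : 0 < (2 * k.+1%:R)^-1 :> R by rewrite invr_gt0 mulr_gt0.
have [i|i d d' d'd [P1 P2]|d d0 Hd] := @finite_common_radius R 'I_k (fun i d =>
    (forall s t : R, `|s| < d -> `|t| < d ->
    `|h i s - h i t - (s - t) *: delta_mx 0 i| <= (2 * k.+1%:R)^-1 * `|s - t|) /\
    (forall t : R, `|t| < d -> H (h i t))).
- have [d1 d10 H1] := hs i _ e0; have [d2 d20 H2] := hH i.
  exists (Num.min d1 d2) => [|]; first by rewrite lt_min d10.
  split=> [s t|t]; rewrite !lt_min => /andP[? ?]; last exact: H2.
  by move=> /andP[? ?]; apply: H1; rewrite subr0.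
- split=> [s t ? ?|t ?]; [apply: P1|apply: P2]; exact: lt_le_trans d'd.
pose rho := d / 2.
have rho0 : 0 < rho by rewrite divr_gt0.
have rhod : rho < d by rewrite /rho; lra.
pose Phi (t : 'rV[R]_k) := \sum_i h i (t 0 i).
have coord_lt (t : 'rV[R]_k) i : `|t| <= rho -> `|t 0 i| < d.
  by move=> tr; rewrite (le_lt_trans (mx_norm_ge_entry t 0 i))// (le_lt_trans tr).
have PhiL s t : `|s| <= rho -> `|t| <= rho ->
    `|(Phi s - s) - (Phi t - t)| <= 2^-1 * `|s - t|.
  move=> sr tr.
  have -> : (Phi s - s) - (Phi t - t) =
      \sum_i (h i (s 0 i) - h i (t 0 i) - (s 0 i - t 0 i) *: delta_mx 0 i).
    rewrite !sumrB; under [X in _ = _ - X]eq_bigr do rewrite scalerBl.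
    by rewrite sumrB -!row_sum_delta /Phi !opprD !opprK addrACA.
  rewrite (le_trans (ler_norm_sum _ _ _))//.
  apply: (@le_trans _ _ (\sum_(i < k) (2 * k.+1%:R)^-1 * `|s - t|)).
    apply: ler_sum => i _.
    have [+ _] := Hd i; move=> /(_ _ _ (coord_lt s i sr)
        (coord_lt t i tr)) /le_trans; apply.
    rewrite ler_wpM2l ?(ltW e0)//.
    by have := mx_norm_ge_entry (s - t) 0 i; rewrite !mxE.
  rewrite sumr_const card_ord -mulrnAl ler_wpM2r//.
  rewrite -mulr_natr invfM -mulrA ler_piMr ?invr_ge0//.
  by rewrite mulrC ler_pdivrMr// mul1r ler_nat.
have Phi0 : Phi 0 = 0 by rewrite /Phi big1// => i _; rewrite mxE.
(* The radius is halved because [s - Phi s] alone may have norm [rho / 2]. *)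
have Hsmall y : `|y| <= rho / 2 -> H y.
  move=> yr.
  have TL s t : `|s| <= rho -> `|t| <= rho ->
     `|(s - Phi s + y) - (t - Phi t + y)| <= 2^-1 * `|s - t|.
    move=> sr tr; have := PhiL s t sr tr.
    have -> : (s - Phi s + y) - (t - Phi t + y) = - ((Phi s - s) - (Phi t - t)).
      by rewrite opprD addrACA subrr addr0 !opprB addrC.
    by rewrite normrN.
  have [s sr|s sr sE] := @closed_ball_fixpoint 'rV[R]_k
      (fun s => s - Phi s + y) rho rho0 _ TL.
    have := TL s 0 sr; rewrite normr0 => /(_ (ltW rho0)).
    rewrite Phi0 subrr add0r subr0 => H1.
    have := ler_normD ((s - Phi s + y) - y) y; rewrite subrK => /le_trans; apply.
    rewrite (le_trans (lerD H1 yr))//.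
    have := sr; lra.
  have -> : y = Phi s by apply: (addrI (s - Phi s)); rewrite sE subrK.
  rewrite /Phi; elim/big_ind : _ => // i _.
  by have [_] := Hd i; apply; exact: coord_lt.
apply/seteqP; split=> // x _.
(* Large enough for [x] divided by [N] to lie in the ball of radius [rho / 2]. *)
pose N := (Num.bound (`|x| / (rho / 2))).+1.
have -> : x = N%:R^-1 *: x *+ N by rewrite -scaler_nat scalerA mulfV ?scale1r// pnatr_eq0.
have : H (N%:R^-1 *: x).
  apply: Hsmall; rewrite normrZ normfV ger0_norm// mulrC ler_pdivrMr//.
  rewrite -ler_pdivrMl ?divr_gt0// mulrC.
  have : 0 <= `|x| / (rho / 2) by rewrite divr_ge0// ltW// divr_gt0.
  move=> /archi_boundP /ltW/le_trans; apply.
  by rewrite ler_nat.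
move: (N%:R^-1 *: x) => z Hz.
by elim: N => [|N IH]; [rewrite mulr0n|rewrite mulrS; exact: HD].
Qed.

End LocalSurjectivity.

(** [V] is only a predicate, so a matrix of maximal rank with rows in [V] serves as a spanning
    family: maximality puts every vector of [V] in its row space, and a nonzero column of its
    cokernel provides [l]. *)
Lemma proper_subspace_annihilator (F : fieldType) k (V : 'rV[F]_k -> Prop) :
  V 0 -> (forall a u v, V u -> V v -> V (a *: u + v)) ->
  (forall v, V v) \/ exists2 l : 'cV[F]_k, l != 0 & forall v, V v -> v *m l = 0.
Proof.
move=> V0 VD.
pose P r := `[< exists m (A : 'M[F]_(m, k)), (forall i, V (row i A)) /\ \rank A = r >].
have P0 : exists r, P r.
  by exists 0%N; apply/asboolP; exists 0%N, 0; split=> [[]//|]; rewrite mxrank0.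
have Pk r : P r -> (r <= k)%N by move=> /asboolP[m [A [_ <-]]]; exact: rank_leq_col.
case: (ex_maxnP P0 Pk) => r /asboolP[m [A [VA rA]]] rmax.
have VB (v : 'rV[F]_k) : (v <= A)%MS -> V v.
  move=> /submxP[w ->]; rewrite mulmx_sum_row.
  elim: (index_enum _) => [|i s IH]; first by rewrite big_nil.
  by rewrite big_cons; apply: VD.
have [fA|nfA] := boolP (row_full A).
  by left=> v; apply: VB; exact: submx_full.
right; have : cokermx A != 0.
  by rewrite -mxrank_eq0 mxrank_coker subn_eq0 -ltnNge ltn_neqAle nfA rank_leq_col.
move=> /eqP cA; have /existsNP[j cj] : ~ forall j, col j (cokermx A) = 0.
  move=> c0; apply: cA; apply/matrixP => i j; have /colP/(_ i) := c0 j.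
  by rewrite !mxE.
exists (col j (cokermx A)); first exact/eqP.
move=> v Vv; suff : (v <= A)%MS by rewrite submxE colE mulmxA => /eqP->; rewrite mul0mx.
have : P (\rank (col_mx A v)).
  apply/asboolP; exists (m + 1)%N, (col_mx A v); split=> // i.
  have [l|l] := split_ordP i => ->; first by rewrite rowKu.
  by rewrite rowKd ord1 [row _ _](_ : _ = v)//; apply/rowP => c; rewrite mxE.
move=> /rmax; rewrite -rA -addsmxE => le_r.
have : (A == A + v)%MS by rewrite -(mxrank_leqif_eq
    (addsmxSl A v)).2 eqn_leq mxrankS ?addsmxSl.
by move=> /eqmxP eA; rewrite eA addsmxSr.
Qed.

(** * The torus action in charts *)

Section Curves.
Context {R : realType}.

Lemma is_derive_comp_curve (V W : normedModType R) (F : V -> W) (c : R -> V) (t : R) p v :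
  c t = p -> is_derive t 1 c v -> differentiable F p ->
  is_derive t 1 (F \o c) ('d F p v).
Proof.
move=> <- [dc <-] dF; have dct : differentiable c t by apply/derivable1_diffP.
have dFc := differentiable_comp dct dF.
split; first exact: diff_derivable.
by rewrite deriveE// diff_comp//= deriveE.
Qed.

Lemma is_derive_curve_continuous (V : normedModType R) (c : R -> V) (t : R) v :
  is_derive t 1 c v -> {for t, continuous c}.
Proof.
by move=> [dc _]; apply: differentiable_continuous; apply/derivable1_diffP.
Qed.

Lemma is_derive_pair (V W : normedModType R) (f : R -> V) (g : R -> W) (t : R) u v :
  is_derive t 1 f u -> is_derive t 1 g v ->
  is_derive t 1 (fun r => (f r, g r)) (u, v).
Proof.
move=> [df <-] [dg <-].
have dft : differentiable f t by apply/derivable1_diffP.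
have dgt : differentiable g t by apply/derivable1_diffP.
have dfg := differentiable_pair dft dgt.
split; first exact: diff_derivable.
by rewrite deriveE// diff_pair//= !deriveE.
Qed.

Lemma is_derive_affine (V : normedModType R) (p v : V) (t : R) :
  is_derive t 1 (fun r : R => p + r *: v) v.
Proof.
rewrite -[X in is_derive _ _ _ X]add0r; apply: is_deriveD.
have d := is_diff_scalel t v.
split; first by apply: diff_derivable; exact: ex_diff.
rewrite deriveE; last exact: ex_diff.
by rewrite diff_val scale1r.
Qed.

Lemma is_derive_unique (V W : normedModType R) (f : V -> W) x v d1 d2 :
  is_derive x v f d1 -> is_derive x v f d2 -> d1 = d2.
Proof. by move=> [_ <-] [_ <-]. Qed.

End Curves.

Section Torus.
Context {R : realType} {k : nat}.

Lemma torus_proj0 : torus_proj (0 : 'rV[R]_k) = 0.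
Proof.
have := torus_projD (0 : 'rV[R]_k) 0; rewrite addr0 => /eqP.
by rewrite -subr_eq subrr => /eqP <-.
Qed.

Lemma torus_proj_surj (t : torus R k) : exists s, torus_proj s = t.
Proof. by exists (repr t); rewrite /torus_proj reprK. Qed.

End Torus.

Section Charts.
Context {R : realType} {n : nat} (M : manifold R n).
Implicit Types (c d : chart R n M).

Lemma cinv_continuous_at c x : ccod c x -> {for x, continuous (cinv c)}.
Proof.
move=> cx; have := @cinv_continuous _ _ _ c.
by rewrite continuous_open_subspace; [apply; rewrite inE|exact: ccod_open].
Qed.

Lemma cmap_continuous_at c p : cdom c p -> {for p, continuous (cmap c)}.
Proof.
move=> cp; have := @cmap_continuous _ _ _ c.
by rewrite continuous_open_subspace; [apply; rewrite inE|exact: cdom_open].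
Qed.

Lemma nbhs_ccod c x : ccod c x -> nbhs x (ccod c).
Proof. by move=> cx; apply: open_nbhs_nbhs; split=> //; exact: ccod_open. Qed.

Lemma nbhs_cdom c p : cdom c p -> nbhs p (cdom c).
Proof. by move=> cp; apply: open_nbhs_nbhs; split=> //; exact: cdom_open. Qed.

End Charts.

Section Action.
Context {R : realType} {n k : nat} {M : manifold R n}.
Variable act : torus R k -> M -> M.
Hypothesis act_smooth : smooth_torus_action act.
Hypothesis act_free : free_action act.
Implicit Types (c d : chart R n M) (s : 'rV[R]_k).

(** The action is pulled back to R^k, a normed space in which it can be differentiated; exactly the
    integral vectors have fixed points. *)
Definition cover_act s (p : M) : M := act (torus_proj s) p.
Local Notation a := cover_act.

Lemma cover_act0 p : a 0 p = p.
Proof. by rewrite /a torus_proj0; case: act_smooth. Qed.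

Lemma cover_actD s t p : a (s + t) p = a s (a t p).
Proof. by rewrite /a torus_projD; case: act_smooth. Qed.

Lemma cover_actC s t p : a s (a t p) = a t (a s p).
Proof. by rewrite -!cover_actD addrC. Qed.

Lemma cover_act_int s p : s \is a mxOver Num.int -> a s p = p.
Proof.
by move=> sZ; rewrite -[RHS]cover_act0 /a; congr act; apply/torus_proj_eq; rewrite subr0.
Qed.

Lemma cover_act_fixed s p : a s p = p -> s \is a mxOver Num.int.
Proof.
by move=> /act_free; rewrite -torus_proj0 => /torus_proj_eq; rewrite subr0.
Qed.

Lemma cover_act_continuous : continuous (fun z : 'rV[R]_k * M => a z.1 z.2).
Proof. by case: act_smooth. Qed.

Lemma cover_act_continuousl p : continuous (fun s => a s p).
Proof.
move=> s; apply: (@continuous_comp _ _ _ (fun s => (s, p)) (fun z => a z.1 z.2)).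
  apply: (@cvg_pair _ _ _ (nbhs s) (nbhs s) (nbhs p) _ _ _ id (cst p));
      first exact: cvg_id.
  exact: cvg_cst.
exact: cover_act_continuous.
Qed.

Lemma orbit_curve_continuous p s : continuous (fun r : R => a (r *: s) p).
Proof.
move=> r; apply: (@continuous_comp _ _ _ (fun r : R => r *: s) (fun s => a s p)).
  exact: scalel_continuous.
exact: cover_act_continuousl.
Qed.

Definition act_dom c d : set ('rV[R]_k * 'rV[R]_n) :=
  [set z | ccod c z.2 /\ cdom d (a z.1 (cinv c z.2))].

Definition act_chart c d (z : 'rV[R]_k * 'rV[R]_n) : 'rV[R]_n :=
  cmap d (a z.1 (cinv c z.2)).

Lemma act_cinv_continuous c (z : 'rV[R]_k * 'rV[R]_n) : ccod c z.2 ->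
  {for z, continuous (fun z => a z.1 (cinv c z.2))}.
Proof.
move=> cz; apply: (@continuous_comp _ _ _
  (fun z : 'rV[R]_k * 'rV[R]_n => (z.1, cinv c z.2)) (fun z => a z.1 z.2)).
  apply: (@cvg_pair _ _ _ (nbhs z) (nbhs z.1) (nbhs (cinv c z.2)) _ _ _ fst
      (cinv c \o snd)); first exact: cvg_fst.
  by apply: (@cvg_comp _ _ _ snd (cinv c) _ (nbhs z.2));
      [exact: cvg_snd|exact: cinv_continuous_at].
exact: cover_act_continuous.
Qed.

Lemma open_act_dom c d : open (act_dom c d).
Proof.
rewrite openE => z [cz dz]; apply: filterI.
  by apply: (@cvg_snd _ _ (nbhs z.1) (nbhs z.2)); exact: nbhs_ccod.
by apply: act_cinv_continuous => //; exact: nbhs_cdom.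
Qed.

Lemma smooth_act_chart c d : atlas c -> atlas d ->
  smooth_on (act_dom c d) (act_chart c d).
Proof. by move=> ac ad; case: act_smooth => _ _ _; apply. Qed.

(** Its rows are the coordinates of the Killing fields generated by the standard basis of R^k. *)
Definition killing_mx c x : 'M[R]_(k, n) :=
  \matrix_(i, j) 'D_(delta_mx 0 i, 0) (act_chart c c) (0, x) 0 j.

Lemma act_dom0 c x : ccod c x -> act_dom c c (0, x).
Proof. by move=> cx; split=> //=; rewrite cover_act0; exact: cinv_fun. Qed.

Lemma diff_act_chart0 c x (s : 'rV[R]_k) : atlas c -> ccod c x ->
  'd (act_chart c c) (0, x) (s, 0) = s *m killing_mx c x.
Proof.
move=> ac cx.
have df := smooth_on_differentiable (smooth_act_chart ac ac) (act_dom0 cx).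
rewrite mulmx_sum_row {1}(row_sum_delta s).
have -> : (\sum_i s 0 i *: delta_mx 0 i, 0) = \sum_i s 0 i *: (delta_mx 0 i, 0)
   :> 'rV[R]_k * 'rV[R]_n.
  elim/big_ind2 : _ => // [[u1 u2] u3 [v1 v2] v3 <- [<- <-]|i _].
    by congr pair; rewrite addr0.
  by congr pair; rewrite scaler0.
rewrite linear_sum; apply: eq_bigr => i _; rewrite linearZ /=; congr (_ *: _).
by apply/rowP => j; rewrite !mxE -deriveE.
Qed.

Definition act_at c d s := cmap d \o a s \o cinv c.

Lemma differentiable_act_at c d s x : atlas c -> atlas d ->
  act_dom c d (s, x) -> differentiable (act_at c d s) x.
Proof.
move=> ac ad sx.
apply: (@differentiable_comp _ _ _ _ (fun x => (s, x)) (act_chart c d)).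
  by apply: differentiable_pair; [exact: differentiable_cst|exact: ex_diff].
exact: smooth_on_differentiable (smooth_act_chart ac ad) _.
Qed.

(* Since T^k is abelian, moving along an orbit and then applying [a s] is the
   same as applying [a s] first: the orbit directions at [a s p] are the images
   of those at [p]. *)
Lemma is_derive_act_chart c d (th : R -> 'rV[R]_k) (x : R -> 'rV[R]_n) (t : R) dth dx :
  atlas c -> atlas d -> act_dom c d (th t, x t) ->
  is_derive t 1 th dth -> is_derive t 1 x dx ->
  is_derive t 1 (fun r => act_chart c d (th r, x r))
    ('D_(dx + dth *m killing_mx c (x t)) (act_at c d (th t)) (x t)).
Proof.
move=> ac ad dom dth' dx'; have [cx ddom] := dom.
have dPhi := smooth_on_differentiable (smooth_act_chart ac ad) dom.
have df := differentiable_act_at ac ad dom.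
have E1 : 'd (act_chart c d) (th t, x t) (0, dx) = 'd (act_at c d (th t)) (x t) dx.
  have H1 : is_derive (0 : R) (1 : R)
      (act_chart c d \o (fun r : R => (th t, x t + r *: dx)))
     ('d (act_chart c d) (th t, x t) (0, dx)).
    apply: is_derive_comp_curve => //; first by rewrite scale0r addr0.
    by apply: is_derive_pair; exact: is_derive_affine.
  apply: is_derive_unique H1 _.
  apply: (@is_derive_comp_curve _ _ _ (act_at c d (th t))
    (fun r : R => x t + r *: dx) 0 (x t)) => //; first by rewrite scale0r addr0.
  exact: is_derive_affine.
(* In the torus direction, [th t + r *: dth] acts as [r *: dth] followed by [th t]. For small [r]
   the intermediate point stays in the domain of [c], so the chain rule factors through this
   chart. *)
have E2 : 'd (act_chart c d) (th t, x t) (dth, 0) =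
    'd (act_at c d (th t)) (x t) (dth *m killing_mx c (x t)).
  have H1 : is_derive (0 : R) (1 : R)
      (act_chart c d \o (fun r : R => (th t + r *: dth, x t)))
     ('d (act_chart c d) (th t, x t) (dth, 0)).
    apply: is_derive_comp_curve => //; first by rewrite scale0r addr0.
    by apply: is_derive_pair; exact: is_derive_affine.
  apply: is_derive_unique H1 _.
  have E0 : act_chart c c (0, x t) = x t by rewrite /act_chart/= cover_act0 cinvK.
  have dc : is_derive (0 : R) (1 : R)
      (act_chart c c \o (fun r : R => (0 + r *: dth, x t)))
      (dth *m killing_mx c (x t)).
    rewrite -diff_act_chart0//; apply: is_derive_comp_curve.
    - by rewrite scale0r addr0.
    - by apply: is_derive_pair; exact: is_derive_affine.
    - exact: smooth_on_differentiable (smooth_act_chart ac ac) (act_dom0 cx).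
  apply: (@near_eq_is_derive _ _ _ (act_at c d (th t) \o
    (act_chart c c \o (fun r : R => (0 + r *: dth, x t))))); last first.
    by apply: is_derive_comp_curve => //=; rewrite scale0r addr0.
  have : nbhs (0 : R) [set r | act_dom c c (0 + r *: dth, x t)].
    have ct : {for (0 : R), continuous (fun r : R => (0 + r *: dth, x t))}.
      by apply: is_derive_curve_continuous (is_derive_pair (is_derive_affine _ _ _)
          (is_derive_cst _ _ _)).
    apply: ct; rewrite /= scale0r addr0.
    by apply: open_nbhs_nbhs; split; [exact: open_act_dom|exact: act_dom0].
  apply: filterS => r [_ /= cr]; rewrite /act_at/act_chart/= cmapK//.
  by rewrite add0r -cover_actD.
have -> : 'D_(dx + dth *m killing_mx c (x t)) (act_at c d (th t)) (x t) =
    'd (act_chart c d) (th t, x t) (dth, dx).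
  rewrite deriveE// linearD -E1 -E2 -linearD; congr ('d _ _ _).
  by congr pair; rewrite ?add0r ?addr0.
exact: (is_derive_comp_curve erefl (is_derive_pair dth' dx')).
Qed.

End Action.

Lemma nbhs0_normP (R : realType) (V : normedModType R) (A : set V) :
  nbhs (0 : V) A -> exists2 d : R, 0 < d & forall t, `|t| < d -> A t.
Proof.
move=> /nbhs_ballP[d /= d0 sub]; exists d => // t td.
by apply: sub; rewrite -ball_normE /= sub0r normrN.
Qed.

Lemma differentiable_norm_le (R : realType) (V W : normedModType R)
    (f : V -> W) p (e : R) :
  differentiable f p -> 0 < e ->
  exists2 d : R, 0 < d & forall h, `|h| < d -> `|f (h + p) - f p - 'd f p h| <= e * `|h|.
Proof.
move=> df e0; have /(_ e e0) := iffLR (eqaddoP _ _ _ _) (diff_locally df).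
move=> /nbhs0_normP[d d0 Hd]; exists d => // h hd.
by have := Hd h hd; rewrite /= !fctE opprD addrA.
Qed.

(** * Killing fields and the connection form *)

Section Infinitesimal.
Context {R : realType} {n k : nat} {M : manifold R n}.
Variables (g : riemannian_metric M) (act : torus R k -> M -> M).
Hypothesis act_smooth : smooth_torus_action act.
Hypothesis act_free : free_action act.
Implicit Types (c d : chart R n M) (s : 'rV[R]_k).
Local Notation a := (cover_act act).
Local Notation K := (killing_mx act).

(** A zero of a Killing field is a fixed point of its flow: the derivative along [r *: s] vanishes,
    so the orbit curve is constant near 0, and by freeness [r *: s] is integral for all small
    [r]. *)
Lemma killing_mx_inj c x s : atlas c -> ccod c x -> s *m K c x = 0 -> s = 0.
Proof.
move=> ac cx sK.
pose th (r : R) : 'rV[R]_k := 0 + r *: s.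
have dth (r : R) : is_derive r 1 th s by exact: is_derive_affine.
have [e e0 He] : exists2 e : R, 0 < e & forall r, `|r| < e -> act_dom act c c (th r, x).
  apply: nbhs0_normP.
  have ct : {for (0 : R), continuous (fun r : R => (th r, x))}.
    exact: is_derive_curve_continuous (is_derive_pair (dth 0) (is_derive_cst x _ _)).
  apply: ct; rewrite /th /= scale0r addr0.
  apply: open_nbhs_nbhs; split; [exact: open_act_dom|exact: act_dom0].
have He' r : - e < r < e -> act_dom act c c (th r, x).
  by move=> re; apply: He; rewrite ltr_norml.
have cst r : - e < r < e -> act_chart act c c (th r, x) = x.
  move=> re; transitivity (act_chart act c c (th 0, x)); last first.
    by rewrite /th scale0r addr0 /act_chart /= cover_act0// cinvK.
  apply: (@is_derive_0_const_itv _ _ _ (fun r => act_chart act c c (th r, x))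
    (- e) e) => //; last by rewrite oppr_lt0 e0.
  move=> t te.
  have := is_derive_act_chart act_smooth ac ac (He' t te) (dth t) (is_derive_cst x t 1).
  by rewrite add0r sK derive0.
have int r : - e < r < e -> r *: s \is a mxOver Num.int.
  move=> re; rewrite -[_ *: _]add0r -/(th r).
  apply: (cover_act_fixed act_free (p := cinv c x)).
  have [_ /= dr] := He' r re.
  by rewrite -(cmapK dr) -[cmap c _]/(act_chart act c c (th r, x)) cst.
(* The second bound makes every entry of [r *: s] at most 1/2 in absolute value, so an integral
   entry is 0. *)
pose r := Num.min (e / 2) (2^-1 / (`|s| + 1)).
have s1 : 0 < `|s| + 1 by rewrite ltr_wpDl.
have r0 : 0 < r by rewrite lt_min !divr_gt0// invr_gt0.
have re : - e < r < e.
  rewrite (lt_trans _ r0) ?oppr_lt0//= gt_min; apply/orP; left; lra.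
apply/rowP => j; rewrite mxE; apply/eqP; apply/negPn/negP => sj.
have /mxOverP/(_ 0 j) := int r re; rewrite mxE => /norm_intr_ge1.
rewrite mulf_eq0 negb_or sj (gt_eqF r0) => /(_ isT); apply/negP; rewrite -ltNge.
rewrite normrM (gtr0_norm r0).
have : r <= 2^-1 / (`|s| + 1) by rewrite ge_min lexx orbT.
rewrite ler_pdivlMr// => H.
have : `|s 0 j| <= `|s| by exact: mx_norm_ge_entry.
move=> H2; have : r * `|s 0 j| <= r * (`|s| + 1).
  by rewrite ler_wpM2l ?(ltW r0)// (le_trans H2)// lerDl.
move: H; lra.
Qed.

Lemma row_free_killing_mx c x : atlas c -> ccod c x -> row_free (K c x).
Proof. by move=> ac cx; apply: inj_row_free => v; exact: killing_mx_inj. Qed.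

Lemma smooth_killing_mx c : atlas c -> smooth_on (ccod c) (K c).
Proof.
move=> ac; have oc := @ccod_open _ _ _ c.
apply: smooth_on_mx => // i j; under eq_fun do rewrite mxE.
apply: (@smooth_on_entry _ _ _ _ _ _
  (fun x => 'D_(delta_mx 0 i, 0) (act_chart act c c) (0, x))) => //.
apply: (@smooth_on_compose _ _ _ _ (coord_pair (coord_mx _ _) (coord_mx _ _))
  (coord_mx _ _) _ (act_dom act c c)
  (fun x => (0, x)) ('D_(delta_mx 0 i, 0) (act_chart act c c))) => //.
- exact: open_act_dom.
- by move=> x cx; exact: act_dom0.
- by apply: smooth_on_pair => //; [exact: smooth_on_cst|exact: smooth_on_id].
- by apply: smooth_on_derive; exact: smooth_act_chart.
Qed.

(** The metric of the orbit in the basis of Killing fields. *)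
Definition orbit_gram c x : 'M[R]_k := K c x *m g c x *m (K c x)^T.

Lemma orbit_gram_unit c x : atlas c -> ccod c x -> orbit_gram c x \in unitmx.
Proof.
move=> ac cx; rewrite -row_free_unit; apply: inj_row_free => v vG.
apply: (killing_mx_inj ac cx).
apply: contrapT => /eqP vK0.
have := gram_posdef g ac cx vK0.
have -> : gdot (g c x) (v *m K c x) (v *m K c x) = (v *m orbit_gram c x *m v^T) 0 0.
  by rewrite /gdot /orbit_gram trmx_mul !mulmxA.
by rewrite vG mul0mx mxE ltxx.
Qed.

(* The matrix, in the chart [c], of the connection form: the orbit component of
   [v] is [v *m connection_mx c x *m killing_mx act c x]. *)
Definition connection_mx c x : 'M[R]_(n, k) :=
  g c x *m (K c x)^T *m invmx (orbit_gram c x).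

Lemma connection_mx_horizontal c x v s : atlas c -> ccod c x ->
  gdot (g c x) (v - v *m connection_mx c x *m K c x) (s *m K c x) = 0.
Proof.
move=> ac cx; rewrite /gdot trmx_mul mulmxA.
suff -> : (v - v *m connection_mx c x *m K c x) *m g c x *m (K c x)^T = 0.
  by rewrite mul0mx mxE.
rewrite -mulmxA mulmxBl -(mulmxA _ (K c x)) [K c x *m _]mulmxA -/(orbit_gram c x).
by rewrite /connection_mx -!mulmxA mulVmx ?orbit_gram_unit// mulmx1 !mulmxA subrr.
Qed.

Lemma smooth_connection_mx c : atlas c -> smooth_on (ccod c) (connection_mx c).
Proof.
move=> ac; have oc := @ccod_open _ _ _ c.
have sK := smooth_killing_mx ac; have sg := gram_smooth g ac.
apply: smooth_on_mulmx => //; first by apply: smooth_on_mulmx => //;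
    exact: smooth_on_trmx.
apply: smooth_on_invmx => //.
  by apply: smooth_on_mulmx => //; [exact: smooth_on_mulmx|exact: smooth_on_trmx].
by move=> x cx; exact: orbit_gram_unit.
Qed.

(** Invariance of the Killing fields of an abelian action: in [s + r *: v] the part [r *: v] may act
    before or after [s], and both readings differentiate the same curve. *)
Lemma killing_mx_act c d s x (v : 'rV[R]_k) : atlas c -> atlas d ->
  act_dom act c d (s, x) ->
  'D_(v *m K c x) (act_at act c d s) x = v *m K d (act_at act c d s x).
Proof.
move=> ac ad dom; have [/= cx dx] := dom.
set y := act_at act c d s x.
have dy : ccod d y by exact: cmap_fun.
have H1 : is_derive (0 : R) (1 : R) (act_chart act d d \o (fun r : R => (0 + r *: v, y)))
    (v *m K d y).
  rewrite -diff_act_chart0//; apply: is_derive_comp_curve.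
  - by rewrite scale0r addr0.
  - by apply: is_derive_pair; exact: is_derive_affine.
  - exact: smooth_on_differentiable (smooth_act_chart act_smooth ad ad)
      (act_dom0 act_smooth dy).
have dom0 : act_dom act c d (s + (0 : R) *: v, x) by rewrite scale0r addr0.
have H2 := is_derive_act_chart act_smooth ac ad dom0 (is_derive_affine s v 0)
  (is_derive_cst x (0 : R) (1 : R)).
move: H2; rewrite scale0r addr0 add0r => H2; apply: is_derive_unique H2 _.
congr (is_derive _ _ _ _): H1.
apply/funext => r; rewrite /act_chart /y /= add0r /act_at/= cmapK//.
by rewrite -cover_actD// addrC.
Qed.

End Infinitesimal.

(** * Vectors tangent to the orbits *)

Section Tangent.
Context {R : realType} {n k : nat} {M : manifold R n}.
Variables (g : riemannian_metric M) (act : torus R k -> M -> M).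
Hypothesis act_smooth : smooth_torus_action act.
Hypothesis act_free : free_action act.
Implicit Types (c d : chart R n M) (s : 'rV[R]_k).
Local Notation a := (cover_act act).
Local Notation K := (killing_mx act).
Local Notation W := (connection_mx g act).

Lemma orbit_proj_eq p q : orbit_proj act q = orbit_proj act p -> exists s, q = a s p.
Proof.
move=> /(congr1 (@proj1_sig _ _)) /= E.
have : orbit_of act q q by exists 0 => //; case: act_smooth.
rewrite E => -[t _ <-]; have [s <-] := torus_proj_surj t.
by exists s.
Qed.

Lemma floor_representative s : exists2 z : 'rV[R]_k,
  z \is a mxOver Num.int & `|s - z| <= 1.
Proof.
exists (\row_j (Num.floor (s 0 j))%:~R).
  by apply/mxOverP => i j; rewrite mxE.
apply: ler_mx_norm => // i j; rewrite !mxE (ord1 i).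
rewrite ger0_norm ?subr_ge0 ?floor_le// lerBlDl.
by rewrite -[1]/(1%:~R) -intrD ltW// floorD1_gt.
Qed.

(** The set [C] below consists of the parameters in the unit ball at distance at least [e] from the
    lattice. Its image in the orbit is compact and avoids [p] by freeness. So if [q] is near [p],
    its parameter, once reduced to the unit ball, is within [e] of an integral vector. *)
Lemma small_torus_representative p e : 0 < e ->
  \forall q \near p, forall s, q = a s p -> exists2 s', `|s'| < e & q = a s' p.
Proof.
move=> e0.
pose C : set 'rV[R]_k := [set s | `|s| <= 1] `&`
  \bigcap_(z in [set z | z \is a mxOver Num.int]) [set s | e <= `|s - z|].
have cC : compact C.
  apply: bounded_closed_compact.
    by exists 1; split=> // x x1 s [s1 _]; exact: (le_trans s1 (ltW x1)).
  apply: closedI.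
    rewrite (_ : [set s | _] = (fun s => `|s|) @^-1` [set r | r <= 1])//.
    by apply: closed_comp => [s _|]; [exact: norm_continuous|exact: closed_le].
  apply: closed_bigI => z _.
  rewrite (_ : [set s | _] = (fun s => `|s - z|) @^-1` [set r | e <= r])//.
  apply: closed_comp => [s _|]; last exact: closed_ge.
  apply: (@continuous_comp _ _ _ (fun s => s - z) (fun s => `|s|));
      last exact: norm_continuous.
  by apply: (cvgB cvg_id); exact: cvg_cst.
have cont : continuous (fun s => a s p) by exact: cover_act_continuousl.
have clC : closed [set a s p | s in C].
  apply: compact_closed; first exact: manifold_hausdorff.
  by apply: continuous_compact cC; exact: continuous_subspaceT.
have pC : (~` [set a s p | s in C]) p.
  move=> [s [_ sC] /(cover_act_fixed act_free) sZ].
  by have := sC s sZ; rewrite /= subrr normr0 leNgt e0.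
have : nbhs p (~` [set a s p | s in C]).
  by apply: open_nbhs_nbhs; split=> //; exact: closed_openC.
apply: filterS => q qC s qE.
have [z zZ sz] := floor_representative s.
have qz : q = a (s - z) p.
  by rewrite qE -{1}(subrK z s) (cover_actD act_smooth (s - z))
      (cover_act_int act_smooth p zZ).
have [z' z'Z sz'] : exists2 z', z' \is a mxOver Num.int & `|s - z - z'| < e.
  apply: contrapT => H; apply: qC; exists (s - z) => //; split => // z' z'Z /=.
  by rewrite leNgt; apply/negP => lt; apply: H; exists z'.
exists (s - z - z') => //.
by rewrite qz -{1}(subrK z' (s - z)) (cover_actD act_smooth (s - z - z'))
    (cover_act_int act_smooth p z'Z).
Qed.

(** Multiplying the first-order expansion of the orbit map by a right inverse [P] of [K d y]
    recovers [s]. The error is taken below [2^-1 / B] times the norm of [s], so that after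
    multiplication by [P] it is at most half of that norm and can be absorbed. *)
Lemma act_chart_expanding d y : atlas d -> ccod d y ->
  exists2 C : R, 0 < C & exists2 e : R, 0 < e & forall s, `|s| < e ->
    `|s| <= C * `|act_chart act d d (s, y) - y|.
Proof.
move=> ad dy.
have /row_freeP[P KP] := row_free_killing_mx act_smooth act_free ad dy.
pose B := n%:R * `|P| + 1.
have B0 : 0 < B by rewrite ltr_wpDl// mulr_ge0.
have df := smooth_on_differentiable (smooth_act_chart act_smooth ad ad)
    (act_dom0 act_smooth dy).
have B20 : 0 < 2^-1 / B by rewrite divr_gt0// invr_gt0.
have [e e0 He] := differentiable_norm_le df B20.
exists (2 * B); first by rewrite mulr_gt0.
exists e => // s se.
have s0 : `|((s, 0) : 'rV[R]_k * 'rV[R]_n)| = `|s|.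
  by rewrite prod_normE /= normr0; apply/max_idPl.
have := He (s, 0); rewrite s0 => /(_ se).
rewrite [(s, 0) + _](_ : _ = (s, y)); last by congr pair; rewrite ?addr0 ?add0r.
rewrite diff_act_chart0//.
have -> : act_chart act d d (0, y) = y by rewrite /act_chart/= cover_act0// cinvK.
move: (act_chart act d d (s, y) - y) => w wK.
have mulP (v : 'rV[R]_n) : `|v *m P| <= B * `|v|.
  by rewrite (le_trans (mulmx_norm_le _ _))// ler_wpM2r// lerDl.
have sE : s = w *m P - (w - s *m K d y) *m P.
  by rewrite mulmxBl opprB addrC subrK -mulmxA KP mulmx1.
have : `|s| <= B * `|w| + 2^-1 * `|s|.
  rewrite {1}sE (le_trans (ler_normB _ _))// lerD// (le_trans (mulP _))//.
  by rewrite -ler_pdivlMl// mulrA mulrC [B^-1 * _]mulrC mulrC.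
by rewrite -mulrA; lra.
Qed.

(* A curve [tau] lying in the orbit of [p] is a priori not the image of a smooth
   curve of parameters, but by compactness of the torus [tau r = a s p] with
   s -> 0, and then s = O(r) because the orbit map is expanding near 0. *)
Lemma tangent_to_orbit d p v (l : 'cV[R]_n) : atlas d -> cdom d p ->
  tangent_to_fiber (orbit_proj act) d p v ->
  K d (cmap d p) *m l = 0 -> v *m l = 0.
Proof.
move=> ad dp [tau [[_ ctau stau] tau0 ftau vtau]] Kl.
set y := cmap d p.
have dy : ccod d y by exact: cmap_fun.
have nd : nbhs (0 : R) (tau @^-1` cdom d).
  by apply: ctau => //; rewrite tau0; exact: nbhs_cdom.
have dtau : differentiable (cmap d \o tau) 0.
  apply: (smooth_on_differentiable (stau d ad)); split=> //.
  exact: nbhs_singleton nd.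
have y0 : (cmap d \o tau) 0 = y by rewrite /= tau0.
have Dtau : 'd (cmap d \o tau) 0 1 = v.
  by rewrite -deriveE// -derive1E -vtau.
have [C C0 [e e0 exp]] := act_chart_expanding ad dy.
have df := smooth_on_differentiable (smooth_act_chart act_smooth ad ad)
    (act_dom0 act_smooth dy).
pose L := n%:R * `|l| + 1.
have L0 : 0 < L by rewrite ltr_wpDl// mulr_ge0.
have mulL (w : 'rV[R]_n) : `|w *m l| <= L * `|w|.
  by rewrite (le_trans (mulmx_norm_le _ _))// ler_wpM2r// lerDl.
pose Q := `|v| + 1.
have Q0 : 0 < Q by rewrite ltr_wpDl.
(* For small [r] the displacement of [tau] is [r *: v] up to [e1 * r], and also [s *m K d y] up to
   [e1] times the norm of [s], which is at most [C * (Q * r)]. As [l] kills [K d y] and multiplies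
   norms by at most [L], dividing by [r] leaves the two terms of this bound. *)
suff vl (e1 : R) : 0 < e1 -> e1 <= 1 -> `|v *m l| <= e1 * (L + L * (C * Q)).
  apply/eqP; rewrite -normr_le0; apply: contrapT => /negP; rewrite -ltNge => vl0.
  pose T := L + L * (C * Q).
  have T0 : 0 < T by rewrite addr_gt0// !mulr_gt0.
  pose e1 := Num.min 1 (`|v *m l| / (2 * T)).
  have e10 : 0 < e1 by rewrite lt_min ltr01 divr_gt0// mulr_gt0.
  have := vl e1 e10; rewrite ge_min lexx => /(_ isT).
  have : e1 <= `|v *m l| / (2 * T) by rewrite ge_min lexx orbT.
  rewrite ler_pdivlMr ?mulr_gt0// -/T; move: vl0; lra.
move=> e10 e11.
have [d1 d10 H1] := differentiable_norm_le df e10.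
have [d2 d20 H2] := differentiable_norm_le dtau e10.
have ed1 : 0 < Num.min e d1 by rewrite lt_min e0.
have [r r0 [rdom [r2 rsmall]]] : exists2 r : R, 0 < r & cdom d (tau r) /\ (r < d2 /\
    exists2 s, `|s| < Num.min e d1 & tau r = a s p).
  have near1 : \forall r \near (0 : R), cdom d (tau r) /\
      exists2 s, `|s| < Num.min e d1 & tau r = a s p.
    have := small_torus_representative p ed1.
    rewrite -tau0 => /(ctau 0 I); rewrite tau0 => near2.
    apply: filterS2 nd near2 => r dr /= H; split=> //.
    by have [s sE] := orbit_proj_eq (ftau r); apply: H sE.
  have [d3 d30 H3] := nbhs0_normP near1.
  pose r := Num.min d2 d3 / 2.
  have m0 : 0 < Num.min d2 d3 by rewrite lt_min d20.
  have r0 : 0 < r by rewrite divr_gt0.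
  have rm : r < Num.min d2 d3 by rewrite /r; lra.
  move: (rm); rewrite lt_min => /andP[rd2 rd3].
  exists r => //; have [|H4 H5] := H3 r; first by rewrite gtr0_norm.
  by split.
have [s + tE] := rsmall; rewrite lt_min => /andP[se sd1].
have yr : cmap d (tau r) = act_chart act d d (s, y).
  by rewrite /act_chart/= /y cmapK// tE.
have rn : `|r| = r by rewrite gtr0_norm.
have := H2 r; rewrite rn addr0 y0 -[X in 'd _ _ X]mulr1 [r * 1](_ : _ = r *: 1)//.
rewrite linearZ Dtau => /(_ r2) /= B1.
have wQ : `|cmap d (tau r) - y| <= Q * r.
  rewrite -[cmap d (tau r) - y](subrK (r *: v)) (le_trans (ler_normD _ _))//.
  rewrite normrZ rn mulrDl mul1r [X in _ <= X]addrC mulrC lerD//.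
  by rewrite (le_trans B1)// ler_piMl// ltW.
have sB : `|s| <= C * (Q * r).
  by rewrite (le_trans (exp s se))// -yr ler_wpM2l ?(ltW C0).
have s0 : `|((s, 0) : 'rV[R]_k * 'rV[R]_n)| = `|s|.
  by rewrite prod_normE /= normr0; apply/max_idPl.
have := H1 (s, 0); rewrite s0 => /(_ sd1).
rewrite [(s, 0) + _](_ : _ = (s, y)); last by congr pair; rewrite ?addr0 ?add0r.
rewrite diff_act_chart0//.
have -> : act_chart act d d (0, y) = y by rewrite /act_chart/= cover_act0// cinvK.
rewrite -yr => B2.
have : r *: (v *m l) = (cmap d (tau r) - y - s *m K d y) *m l
    - (cmap d (tau r) - y - r *: v) *m l.
  rewrite -mulmxBl opprB addrC addrA subrK.
  by rewrite mulmxBl -mulmxA Kl mulmx0 subr0 scalemxAl.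
move=> /(congr1 Num.norm); rewrite normrZ rn => E.
suff : r * `|v *m l| <= r * (e1 * (L + L * (C * Q))) by rewrite ler_pM2l.
rewrite E (le_trans (ler_normB _ _))//.
have A1 := mulL (cmap d (tau r) - y - s *m K d y).
have A2 := mulL (cmap d (tau r) - y - r *: v).
have A3 : L * `|cmap d (tau r) - y - s *m K d y| <= L * (e1 * (C * (Q * r))).
  by rewrite ler_wpM2l ?(ltW L0)// (le_trans B2)// ler_wpM2l// ltW.
have A4 : L * `|cmap d (tau r) - y - r *: v| <= L * (e1 * r).
  by rewrite ler_wpM2l ?(ltW L0).
rewrite (le_trans (lerD (le_trans A1 A3) (le_trans A2 A4)))//.
by rewrite le_eqVlt; apply/orP; left; apply/eqP; ring.
Qed.

End Tangent.

(** * Horizontal curves *)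

Section SmoothCurves.
Context {R : realType}.

Lemma derive_real_scale (V : normedModType R) (F : R -> V) (t v : R) :
  differentiable F t -> 'D_v F t = v *: 'D_1 F t.
Proof.
by move=> dF; rewrite !deriveE// -[v in LHS]mulr1 -[v * 1]/(v *: 1) linearZ.
Qed.

Lemma smooth_on_antiderivative m n (U : set R) (F g : R -> 'M[R]_(m, n)) :
  open U -> (forall t : R, U t -> is_derive t 1 F (g t)) ->
  smooth_on U g -> smooth_on U F.
Proof.
move=> oU dF sg.
have diffF t : U t -> differentiable F t.
  by move=> /dF[d _]; apply/derivable1_diffP.
apply: (@smooth_on_coind _ _ _ _ (fun h => smooth_on U h \/ h = F)) => //; last by right.
  by move=> h [sh|->] t Ut; [exact: smooth_on_differentiable Ut|exact: diffF].
move=> h v [sh|->].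
  by exists ('D_v h) => //; left; exact: smooth_on_derive.
exists (fun t => v *: g t).
  by left; apply: smooth_on_scalemx => //; exact: smooth_on_cst.
move=> t Ut; rewrite derive_real_scale; last exact: diffF.
by have [_ ->] := dF t Ut.
Qed.

Lemma smooth_on_affine (V : normedModType R) (U : set R) (p v : V) :
  open U -> smooth_on U (fun t : R => p + t *: v).
Proof.
move=> oU; apply: (@smooth_on_coind _ _ _ _ (fun h =>
    (exists p v : V, h = fun t : R => p + t *: v)
  \/ exists p : V, h = cst p)) => //.
- move=> h [[{}p [{}v ->]]|[{}p ->]] t _; last exact: differentiable_cst.
  by apply/derivable1_diffP; have [] := is_derive_affine p v t.
- move=> h w [[{}p [{}v ->]]|[{}p ->]].
    exists (cst (w *: v)); first by right; exists (w *: v).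
    move=> t _; rewrite derive_real_scale.
      by have [_ ->] := is_derive_affine p v t.
    by apply/derivable1_diffP; have [] := is_derive_affine p v t.
  by exists (cst 0); [right; exists 0|move=> t _; exact: derive_cst].
- by left; exists p, v.
Qed.

End SmoothCurves.

Section Horizontal.
Context {R : realType} {n k : nat} {M : manifold R n}.
Variables (g : riemannian_metric M) (act : torus R k -> M -> M).
Hypothesis act_smooth : smooth_torus_action act.
Hypothesis act_isometric : isometric_action g act.
Hypothesis act_free : free_action act.
Implicit Types (c d : chart R n M) (s : 'rV[R]_k).
Local Notation a := (cover_act act).
Local Notation K := (killing_mx act).
Local Notation W := (connection_mx g act).

(* Data whose lift [t |-> a (th t) (cinv c (x t))] is horizontal. *)
Definition horizontal_data c (U : set R) (x : R -> 'rV[R]_n) (th : R -> 'rV[R]_k) :=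
  [/\ open U, smooth_on U x, smooth_on U th, forall t, U t -> ccod c (x t) &
      forall t, U t -> 'D_1 th t = - ('D_1 x t *m W c (x t))].

(** By [is_derive_act_chart] the velocity is the image under the isometry [a (th t)] of the
    horizontal part of the derivative of [x]. Isometries preserve orthogonality, and the Killing
    fields they have to be tested against are invariant. *)
Lemma horizontal_lift c U x th : atlas c -> horizontal_data c U x th ->
  smooth_curve U (fun t => a (th t) (cinv c (x t))) /\
  forall t, U t ->
    orthogonal_to_fiber g (orbit_proj act) (fun t => a (th t) (cinv c (x t))) t.
Proof.
move=> ac [oU sx sth cx dth].
have dx t : U t -> is_derive t 1 x ('D_1 x t).
  by move=> Ut; apply: derivableP; apply: diff_derivable;
      exact: smooth_on_differentiable Ut.
have dth' t : U t -> is_derive t 1 th (- ('D_1 x t *m W c (x t))).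
  move=> Ut; rewrite -dth//.
  by apply: derivableP; apply: diff_derivable; exact: smooth_on_differentiable Ut.
pose gam t := a (th t) (cinv c (x t)); rewrite -/gam.
have cg t : U t -> {for t, continuous gam}.
  move=> Ut; apply: (@continuous_comp _ _ _ (fun t => (th t, x t))
    (fun z : 'rV[R]_k * 'rV[R]_n => a z.1 (cinv c z.2))).
    exact: is_derive_curve_continuous (is_derive_pair (dth' t Ut) (dx t Ut)).
  by apply: act_cinv_continuous => //=; exact: cx.
split.
  split=> // d ad.
  have oUd : open (U `&` gam @^-1` cdom d).
    rewrite openE => t [Ut dt]; apply: filterI.
      by apply: open_nbhs_nbhs.
    by apply: cg => //; exact: nbhs_cdom.
  apply: (@smooth_on_compose _ _ _ _ (coord_pair (coord_mx _ _) (coord_mx _ _))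
    (coord_mx _ _) _ (act_dom act c d) (fun t => (th t, x t)) (act_chart act c d)) => //.
  - exact: open_act_dom.
  - by move=> t [Ut dt]; split=> //=; exact: cx.
  - by apply: smooth_on_pair => //; apply: smooth_on_sub (_ : _ `<=` U) _ => // t [].
  - exact: smooth_act_chart.
move=> t Ut d ad dgt v tv.
have dom : act_dom act c d (th t, x t) by split=> //; exact: cx.
have [_ vel] := is_derive_act_chart act_smooth ac ad dom (dth' t Ut) (dx t Ut).
have -> : velocity d gam t = 'D_('D_1 x t + - ('D_1 x t *m W c (x t)) *m K c (x t))
   (act_at act c d (th t)) (x t).
  by rewrite -vel /velocity derive1E.
set u := 'D_1 x t + _; set w := 'D_u _ _; set y := act_at act c d (th t) (x t).
have -> : cmap d (gam t) = y by [].
(* [tangent_to_orbit] is applied to the linear form that pairs a vector with the velocity [w], which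
   leaves only the Killing fields to test. *)
suff Kl : K d y *m (w *m g d y)^T = 0.
  have := tangent_to_orbit act_smooth act_free ad dgt tv Kl.
  move=> /(congr1 trmx); rewrite trmx_mul trmxK /gdot => ->.
  by rewrite trmx0 mxE.
apply/row_matrixP => i; rewrite row_mul rowE -killing_mx_act//.
have := act_isometric ac ad (cx t Ut) dgt u (delta_mx 0 i *m K c (x t)).
rewrite {2}/u mulNmx connection_mx_horizontal //; last exact: cx.
move=> H.
rewrite row0; apply/rowP => j; rewrite ord1 [RHS]mxE -[RHS]H.
by rewrite /gdot -[in RHS](trmxK (w *m _)) -[in RHS]trmx_mul [RHS]mxE.
Qed.

End Horizontal.

(** * Chains of horizontal arcs as an invariant equivalence relation *)

Section Reach.
Context {R : realType} {n k : nat} {M : manifold R n}.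
Variables (g : riemannian_metric M) (act : torus R k -> M -> M).
Hypothesis act_smooth : smooth_torus_action act.
Hypothesis act_isometric : isometric_action g act.
Hypothesis act_free : free_action act.
Implicit Types (c d : chart R n M) (s : 'rV[R]_k) (p q : M).
Local Notation a := (cover_act act).

(** Used with slopes 1 and -1, to place an arc on any unit interval and to reverse it. *)
Lemma horizontal_data_affine c U x th (al be : R) :
  horizontal_data g act c U x th ->
  horizontal_data g act c ((fun t => be + t *: al) @^-1` U)
    (x \o (fun t => be + t *: al)) (th \o (fun t => be + t *: al)).
Proof.
move=> [oU sx sth cx dth]; set rho := fun t : R => be + t *: al.
have drho (t : R) : is_derive t 1 rho al by exact: is_derive_affine.
have oV : open (rho @^-1` U).
  by apply: open_comp => // t _; exact: is_derive_curve_continuous (drho t).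
have srho : smooth_on (rho @^-1` U) rho.
  exact: smooth_on_affine.
have der (m : nat) (f : R -> 'rV[R]_m) t : smooth_on U f -> U (rho t) ->
    'D_1 (f \o rho) t = al *: 'D_1 f (rho t).
  move=> sf Ut; have df := smooth_on_differentiable sf Ut.
  have [_ ->] := is_derive_comp_curve erefl (drho t) df.
  by rewrite -deriveE// derive_real_scale.
split=> //.
- by apply: (@smooth_on_compose _ _ _ _ coordR (coord_mx _ _) _ U rho x).
- by apply: (@smooth_on_compose _ _ _ _ coordR (coord_mx _ _) _ U rho th).
- by move=> t /cx.
- by move=> t Ut; rewrite !der// dth// scalerN scalemxAl.
Qed.

Lemma horizontal_data_translate c U x th s :
  horizontal_data g act c U x th ->
  horizontal_data g act c U x (fun t => s + th t).
Proof.
move=> [oU sx sth cx dth]; split=> //.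
  by apply: smooth_on_addmx => //; exact: smooth_on_cst.
move=> t Ut; rewrite -dth//.
have dt : derivable th t 1 by apply: diff_derivable; exact: smooth_on_differentiable Ut.
have [_ ->] := is_deriveD (is_derive_cst s t 1) (derivableP dt).
by rewrite add0r.
Qed.

(** Quantifying over the starting time [b] lets an arc be appended to a curve that ends at any
    time. *)
Definition arc p q := forall b : R, exists U sigma,
  [/\ smooth_curve U sigma, `[b, b + 1]%classic `<=` U,
      forall t, t \in `[b, b + 1] -> orthogonal_to_fiber g (orbit_proj act) sigma t,
      sigma b = p & sigma (b + 1) = q].

Lemma arc_of_horizontal_data c U x th : atlas c -> horizontal_data g act c U x th ->
  `[0, 1]%classic `<=` U ->
  arc (a (th 0) (cinv c (x 0))) (a (th 1) (cinv c (x 1))) /\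
  arc (a (th 1) (cinv c (x 1))) (a (th 0) (cinv c (x 0))).
Proof.
move=> ac H U01; split=> b.
- have H' := horizontal_data_affine 1 (- b) H.
  have [sc oc] := horizontal_lift act_smooth act_isometric act_free ac H'.
  have sub t : t \in `[b, b + 1] -> U (- b + t *: 1).
    by rewrite in_itv/= => tb; apply: U01; rewrite /= in_itv/= [_ *: _]mulr1;
        move: tb; lra.
  eexists; eexists; split; first exact: sc.
  + by move=> t tb; apply: sub.
  + by move=> t tb; apply: oc; exact: sub.
  + by rewrite /= (_ : - b + b *: 1 = 0)// [b *: 1]mulr1 addNr.
  + by rewrite /= (_ : - b + (b + 1) *: 1 = 1)// [_ *: 1]mulr1 addKr.
- have H' := horizontal_data_affine (- 1) (b + 1) H.
  have [sc oc] := horizontal_lift act_smooth act_isometric act_free ac H'.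
  have E t : b + 1 + t *: - 1 = b + 1 - t by rewrite [_ *: _]mulrN1.
  have sub t : t \in `[b, b + 1] -> U (b + 1 + t *: - 1).
    by rewrite in_itv/= => tb; apply: U01; rewrite /= in_itv/= E; move: tb; lra.
  eexists; eexists; split; first exact: sc.
  + by move=> t tb; apply: sub.
  + by move=> t tb; apply: oc; exact: sub.
  + by rewrite /= E addrAC subrr add0r.
  + by rewrite /= E subrr.
Qed.

(** Reversal and all translates are built in, so that symmetry and invariance of [reach] follow by
    plain induction. *)
Definition link p q := forall s, arc (a s p) (a s q) /\ arc (a s q) (a s p).

Lemma link_of_horizontal_data c U x th : atlas c -> horizontal_data g act c U x th ->
  `[0, 1]%classic `<=` U ->
  link (a (th 0) (cinv c (x 0))) (a (th 1) (cinv c (x 1))).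
Proof.
move=> ac H U01 s; rewrite -!cover_actD//.
exact: arc_of_horizontal_data ac (horizontal_data_translate s H) U01.
Qed.

Inductive reach p : M -> Prop :=
| reach_refl : reach p p
| reach_step q r : reach p q -> link q r -> reach p r.

Lemma reach_trans p q r : reach p q -> reach q r -> reach p r.
Proof. by move=> pq; elim=> // r1 r2 _ IH; exact: reach_step. Qed.

Lemma link_reach p q : link p q -> reach p q.
Proof. by move=> pq; apply: reach_step pq; exact: reach_refl. Qed.

Lemma reach_sym p q : reach p q -> reach q p.
Proof.
elim=> [|q1 q2 _ IH l]; first exact: reach_refl.
apply: reach_trans IH; apply: link_reach => s.
by have [] := l s.
Qed.

Lemma reach_act s p q : reach p q -> reach (a s p) (a s q).
Proof.
elim=> [|q1 q2 _ IH l]; first exact: reach_refl.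
by apply: reach_step IH _ => t; rewrite -!cover_actD//; exact: l.
Qed.

Lemma dual_leaf_arc p q r :
  dual_leaf g (orbit_proj act) p q -> arc q r -> dual_leaf g (orbit_proj act) p r.
Proof.
move=> [b [e [gam [[s pt hs] gb ge]]]] qr.
have [U [sig [ssig Ub osig sig0 sig1]]] := qr e.
have ee1 : e < e + 1 by rewrite ltrDl.
exists b, (e + 1), (fun t => if t <= e then gam t else sig t).
split; last 2 first.
- by rewrite (itv_partition_le pt).
- by rewrite leNgt ee1.
exists (rcons s (e + 1)).
  by rewrite -cats1; apply: itv_partition_cat pt _; exact: itv_partition1.
(* The appended arc is the piece of index [size s]; earlier pieces keep their end points. *)
move=> i; rewrite size_rcons ltnS leq_eqVlt => /predU1P[->|si].
  have -> : nth (e + 1) (b :: rcons s (e + 1)) (size s) = e.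
    by rewrite -rcons_cons nth_rcons ltnSn (itv_partition_nth_size _ pt).
  have -> : nth (e + 1) (b :: rcons s (e + 1)) (size s).+1 = e + 1.
    by rewrite /= nth_rcons ltnn eqxx.
  exists U, sig; split=> // t; rewrite in_itv/= => /andP[et _].
  (* At the junction the curve takes the value of [gam], which agrees with [sig] there. *)
  case: ifP => // te; have -> : t = e by apply/eqP; rewrite eq_le te.
  by rewrite ge sig0.
have E j : (j <= size s)%N -> nth (e + 1) (b :: rcons s (e + 1)) j = nth e (b :: s) j.
  move=> js; rewrite -rcons_cons nth_rcons ltnS js.
  by apply: set_nth_default.
rewrite !E//; last exact: ltnW.
have [V [tau [stau Vtau gtau otau]]] := hs i si.
exists V, tau; split=> // t /[dup] ti; rewrite in_itv/= => /andP[_ te].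
have te' : t <= e by apply: (le_trans te);
    exact: (@itv_partition_nth_le _ _ b e s i.+1 si pt).
by rewrite te' gtau.
Qed.

Lemma reach_dual_leaf p q : reach p q -> dual_leaf g (orbit_proj act) p q.
Proof.
elim=> [|q1 q2 _ IH l].
  (* A constant curve on [0, 0] with the empty partition: there is no arc to check. *)
  exists 0, 0, (fun=> p); split=> //; exists [::] => [|i //].
  by rewrite /itv_partition /=.
apply: dual_leaf_arc IH _; have [+ _] := l 0.
by rewrite !cover_act0.
Qed.

End Reach.

(** Horizontal data live on an open neighbourhood of [0, 1], so a segment inside a ball has to be
    prolonged at both ends. *)
Lemma segment_margin (R : realType) (V : normedModType R) (v : V)
    (rho : R) : `|v| < rho ->
  exists2 e : R, 0 < e & forall t, - e < t < 1 + e -> `|t *: v| < rho.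
Proof.
move=> vr; have v1 : 0 < `|v| + 1 by rewrite ltr_wpDl.
pose e := (rho - `|v|) / (`|v| + 1).
have e0 : 0 < e by rewrite divr_gt0// subr_gt0.
exists e => // t /andP[t1 t2].
have : `|t| < 1 + e by rewrite ltr_norml; apply/andP; split; lra.
have : e * (`|v| + 1) = rho - `|v| by rewrite /e divfK// gt_eqF.
rewrite normrZ mulrDr mulr1 => eE te.
have : `|t| * `|v| <= (1 + e) * `|v| by rewrite ler_wpM2r// ltW.
rewrite mulrDl mul1r; lra.
Qed.

(** * Integrating the connection form along segments of a chart *)

Section LocalSection.
Context {R : realType} {n k : nat} {M : manifold R n}.
Variables (g : riemannian_metric M) (act : torus R k -> M -> M).
Hypothesis act_smooth : smooth_torus_action act.
Hypothesis act_isometric : isometric_action g act.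
Hypothesis act_free : free_action act.
Implicit Types (c d : chart R n M) (s : 'rV[R]_k) (p q : M).
Local Notation a := (cover_act act).
Local Notation W := (connection_mx g act).
Local Notation reach := (reach g act).

(** The connection form pulled back to the segment from [x0] to [x1]. *)
Let segment_form c (x0 x1 : 'rV[R]_n) (t : R) : 'rV[R]_k :=
  (x1 - x0) *m W c (x0 + t *: (x1 - x0)).

Let segment_primitive c x0 (rho : R) : atlas c ->
  (forall x, `|x - x0| < rho -> ccod c x) -> forall x1, `|x1 - x0| < rho ->
  exists F : R -> 'rV[R]_k, exists2 e : R, 0 < e & forall t, - e < t < 1 + e ->
    ccod c (x0 + t *: (x1 - x0)) /\ is_derive t 1 F (segment_form c x0 x1 t).
Proof.
move=> ac sub x1 x1r; have [e e0 He] := segment_margin x1r.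
have cc t : - e < t < 1 + e -> ccod c (x0 + t *: (x1 - x0)).
  by move=> te; apply: sub; rewrite addrAC subrr add0r; exact: He.
have sW := smooth_connection_mx g act_smooth act_free ac.
have [||| F HF] := @antiderivative_mx R 1 k (segment_form c x0 x1)
    (- e) (1 + e) (- (e / 2)) (1 + e / 2).
- move=> t te; apply: differentiable_continuous.
  apply: (@smooth_on_differentiable _ _ _ `]- e, 1 + e[%classic);
      last by rewrite /= in_itv.
  apply: smooth_on_mulmx; [exact: interval_open|exact: smooth_on_cst
      (interval_open _ _)|].
  apply: (@smooth_on_compose _ _ _ _ (coord_mx _ _) (coord_mx _ _) _ (ccod c)
    (fun t : R => x0 + t *: (x1 - x0)) (W c)) => //.
  + exact: ccod_open.
  + by apply: smooth_on_affine; exact: interval_open.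
- lra.
- lra.
exists F; exists (e / 2); first by rewrite divr_gt0.
move=> t te; split; last exact: HF.
by apply: cc; move: te => /andP[? ?]; apply/andP; split; lra.
Qed.

(** [S x1] is the integral of the connection form along the segment from [x0] to [x1]; correcting
    the segment by the running integral makes it horizontal. Regularity is stated along smooth
    paths, which reduces it to differentiating an integral in one real parameter. *)
Lemma local_section c x0 (rho : R) : atlas c ->
  (forall x, `|x - x0| < rho -> ccod c x) ->
  exists S : 'rV[R]_n -> 'rV[R]_k,
    (forall x1, `|x1 - x0| < rho -> reach (a (S x1) (cinv c x0)) (cinv c x1)) /\
    (forall (x : R -> 'rV[R]_n) (al be : R), smooth_on `]al, be[%classic x ->
       (forall r, al < r < be -> `|x r - x0| < rho) ->
       forall r0, al < r0 < be -> exists v, strict_derive (S \o x) r0 v).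
Proof.
move=> ac sub.
have sW := smooth_connection_mx g act_smooth act_free ac.
(* The primitives are picked for each [x1] separately, with no regularity in [x1]. Only the
   difference of their values at 1 and 0 is used, and it does not depend on the choice. *)
have /choice[F HF] : forall x1, exists F : R -> 'rV[R]_k, `|x1 - x0| < rho ->
    exists2 e : R, 0 < e & forall t, - e < t < 1 + e ->
    ccod c (x0 + t *: (x1 - x0)) /\ is_derive t 1 F (segment_form c x0 x1 t).
  move=> x1; have [x1r|x1r] := pselect (`|x1 - x0| < rho); last by exists (cst 0) => /x1r.
  by have [F HF] := segment_primitive ac sub x1r; exists F.
exists (fun x1 => F x1 1 - F x1 0); split.
  move=> x1 x1r; have [e e0 He] := HF x1 x1r.
  pose U : set R := `]- e, 1 + e[%classic.
  have oU : open U by exact: interval_open.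
  have Ue t : U t -> - e < t < 1 + e by rewrite /U/= in_itv.
  have saff : smooth_on U (fun t : R => x0 + t *: (x1 - x0)).
    exact: smooth_on_affine.
  have dth t : U t -> is_derive t 1 (fun t => F x1 0 - F x1 t) (- segment_form c x0 x1 t).
    move=> /Ue/He[_ d]; have := is_deriveB (is_derive_cst (F x1 0) t 1) d.
    by rewrite sub0r.
  have H : horizontal_data g act c U (fun t => x0 + t *: (x1 - x0))
      (fun t => F x1 0 - F x1 t).
    split=> //.
    - apply: smooth_on_antiderivative dth _ => //.
      rewrite (_ : (fun t => _) = (fun t => (x0 - x1) *m W c (x0 + t *: (x1 - x0))));
          last first.
        by apply/funext => t; rewrite /segment_form -mulNmx opprB.
      apply: (smooth_on_mulmx oU (smooth_on_cst _ oU)).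
      apply: (@smooth_on_compose _ _ _ _ (coord_mx _ _) (coord_mx _ _) _ (ccod c)
        (fun t : R => x0 + t *: (x1 - x0)) (W c)) => //.
      + exact: ccod_open.
      + by move=> t /Ue/He[].
    - by move=> t /Ue/He[].
    - move=> t Ut; have [_ ->] := dth t Ut.
      by have [_ ->] := is_derive_affine x0 (x1 - x0) t.
  have U01 : `[0, 1]%classic `<=` U.
    by move=> t; rewrite /U/= !in_itv/= => /andP[? ?]; apply/andP; split; lra.
  have := link_of_horizontal_data act_smooth act_isometric act_free ac H U01.
  rewrite /= subrr scale0r addr0 scale1r [x0 + _]addrC subrK cover_act0// => /link_reach.
  (* The lift ends at [cinv c x1] moved by [F x1 0 - F x1 1]; the opposite translation brings its
     end to [cinv c x1]. *)
  move=> /(reach_act act_smooth (F x1 1 - F x1 0)).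
  rewrite -[in X in reach _ X]cover_actD//.
  by rewrite addrA subrK subrr cover_act0.
move=> x al be sx xr r0 r0ab.
suff /choice[v Hv] : forall j : 'I_k, exists v : R,
    strict_derive (fun r => (F (x r) 1 - F (x r) 0) 0 j) r0 v.
  exists (\row_j v j); apply: strict_derive_mxP => i j.
  by rewrite ord1 mxE; exact: Hv.
move=> j.
pose V0 : set (R * R) := [set z | z.2 \in `]al, be[].
have oV0 : open V0.
  rewrite (_ : V0 = snd @^-1` `]al, be[%classic)//.
  by apply: open_comp; [move=> z _; exact: cvg_snd|exact: interval_open].
have coordRR : coordinates (R * R)%type by apply: coord_pair; exact: coordR.
have sx2 : smooth_on V0 (fun z => x z.2 - x0).
  apply: smooth_on_addmx => //; last exact: (smooth_on_cst (- x0) oV0).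
  apply: (@smooth_on_compose _ _ _ _ coordR (coord_mx _ _) _
      `]al, be[%classic snd x) => //.
  exact: smooth_on_snd.
have sX : smooth_on V0 (fun z => x0 + z.1 *: (x z.2 - x0)).
  apply: smooth_on_addmx => //; first exact: (smooth_on_cst x0 oV0).
  apply: smooth_on_scalemx => //.
  exact: smooth_on_fst.
(* Pairs of a time on the segment and a parameter of the path, on which the integrand is smooth. *)
pose V : set (R * R) := [set z | V0 z /\ ccod c (x0 + z.1 *: (x z.2 - x0))].
have oV : open V.
  rewrite openE => z [z0 cz]; apply: filterI; first by apply: open_nbhs_nbhs.
  have cX := differentiable_continuous (smooth_on_differentiable sX z0).
  by apply: cX; exact: nbhs_ccod.
have VV0 : V `<=` V0 by move=> z [].
pose G (z : R * R) := segment_form c x0 (x z.2) z.1 0 j.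
have sGm : smooth_on V (fun z : R * R => segment_form c x0 (x z.2) z.1).
  apply: (smooth_on_mulmx oV (smooth_on_sub VV0 sx2)).
  have sXV := smooth_on_sub VV0 sX.
  apply: (@smooth_on_compose _ _ _ _ (coord_mx _ _) (coord_mx _ _) V (ccod c)
    (fun z : R * R => x0 + z.1 *: (x z.2 - x0)) (W c) oV (@ccod_open _ _ _ c) _ sXV sW).
  by move=> z [].
have sG : smooth_on V G by exact: (smooth_on_entry oV 0 j sGm).
have V01 t r : 0 <= t <= 1 -> al < r < be -> V (t, r).
  move=> t01 rab; split; first by rewrite /V0/= in_itv.
  have [e e0 He] := HF _ (xr r rab).
  by apply: (He t _).1; move: t01 => /andP[? ?]; apply/andP; split; lra.
pose G2 t r := 'D_(0, 1) G (t, r).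
have cG2 z : V z -> {for z, continuous ('D_(0, 1) G)}.
  move=> Vz; apply: differentiable_continuous.
  exact: (smooth_on_differentiable (smooth_on_derive _ sG) Vz).
have [w Hw] : exists w : R -> R, forall t : R, 0 <= t <= 1 -> is_derive t 1 w (G2 t r0).
  have [e e0 He] := HF _ (xr r0 r0ab).
  have [||| w Hw] := @antiderivative R (fun t => G2 t r0)
      (- e) (1 + e) (- (e / 2)) (1 + e / 2).
  - move=> t te; apply: (@continuous_comp _ _ _ (fun t => (t, r0)) ('D_(0, 1) G)).
      exact: is_derive_curve_continuous (is_derive_pair (is_derive_id t 1)
          (is_derive_cst r0 t 1)).
    apply: cG2; split; first by rewrite /V0/= in_itv.
    exact: (He t te).1.
  - lra.
  - lra.
  exists w => t t01; apply: Hw; move: t01 => /andP[? ?]; apply/andP; split; lra.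
exists (w 1 - w 0).
have dG (t r : R) : 0 <= t <= 1 -> al < r < be ->
    is_derive r 1 (fun r => G (t, r)) (G2 t r).
  move=> t01 rab; rewrite /G2.
  have dGz := smooth_on_differentiable sG (V01 t r t01 rab).
  rewrite deriveE//.
  exact: (is_derive_comp_curve erefl (is_derive_pair (is_derive_cst t r 1)
      (is_derive_id r 1)) dGz).
have cG2' t : 0 <= t <= 1 -> {for (t, r0), continuous (fun p : R * R => G2 p.1 p.2)}.
  have E : (fun p : R * R => G2 p.1 p.2) = 'D_(0, 1) G by apply/funext => -[].
  by move=> t01; rewrite E; apply: cG2; exact: V01.
have dF (r t : R) : al < r < be -> 0 <= t <= 1 ->
    is_derive t 1 (fun t => F (x r) t 0 j) (G (t, r)).
  move=> rab t01; have [e e0 He] := HF _ (xr r rab).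
  have te : - e < t < 1 + e by move: t01 => /andP[? ?]; apply/andP; split; lra.
  by have [_ /is_derive_mxP/(_ 0 j)] := He t te.
have := strict_derive_parameter_integral r0ab dG cG2' dF Hw.
rewrite (_ : (fun r => F (x r) 1 0 j - F (x r) 0 0 j) =
  (fun r => (F (x r) 1 - F (x r) 0) 0 j))//.
by apply/funext => r; rewrite !mxE.
Qed.

End LocalSection.

(** * Monodromy over a square *)

Section LocallyConstant.
Context {R : realType}.

Lemma locally_constant_connected (T : topologicalType) (V : eqType) (C : set T)
    (D : T -> V) :
  connected C ->
  (forall z, C z -> \forall z' \near z, C z' -> D z' = D z) ->
  forall z w, C z -> C w -> D z = D w.
Proof.
move=> cC loc z w Cz Cw.
pose B := [set y | C y /\ D y = D w].
suff : B = C by move=> BC; have [_] : B z by rewrite BC.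
apply: cC.
- by exists w.
- exists (interior [set y | C y -> D y = D w]); first exact: open_interior.
  apply/seteqP; split=> y [Cy].
    by move=> Dy; split=> //; have := loc y Cy; rewrite Dy.
  by move=> /interior_subset/(_ Cy).
- exists (~` interior [set y | C y -> D y <> D w]).
    by apply: open_closedC; exact: open_interior.
  apply/seteqP; split=> y [Cy].
    by move=> Dy; split=> // /interior_subset/(_ Cy).
  move=> nI; split=> //; apply: contrapT => nD; apply: nI.
  have := loc y Cy; apply: filterS => y' E Cy'; rewrite E//.
Qed.

(** A supremum argument. The step goes from any [u] to any later [v] near [t], on either side of
    [t], so that one [e] serves both to reach the supremum and to pass it. *)
Lemma real_induction (P : R -> Prop) : P 0 ->
  (forall t, 0 <= t <= 1 -> exists2 e, 0 < e & forall u v,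
     0 <= u -> u <= v -> v <= 1 -> `|u - t| < e -> `|v - t| < e -> P u -> P v) ->
  P 1.
Proof.
move=> P0 loc; pose E := [set t | 0 <= t <= 1 /\ P t].
have E0 : E 0 by split=> //; rewrite lexx ler01.
have ubE : ubound E 1 by move=> t [/andP[]].
have hsE : has_sup E by split; [exists 0|exists 1].
pose T := sup E.
have T0 : 0 <= T by apply: ub_le_sup => //; exists 1.
have T1 : T <= 1 by apply: ge_sup => //; exists 0.
have T01 : 0 <= T <= 1 by rewrite T0.
have [e e0 He] := loc T T01.
have [u [/andP[u0 u1] Pu] Tu] := sup_adherent e0 hsE; rewrite -/T in Tu.
have uT : u <= T by apply: ub_le_sup; [exists 1|split=> //; rewrite u0].
have [T1'|T1'] := leP 1 (T + e / 2).
  apply: (He u 1) => //; rewrite ltr_norml; apply/andP; split; lra.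
have Pv : P (T + e / 2).
  by apply: (He u) => //; rewrite ?ltr_norml; try (apply/andP; split); lra.
have : T + e / 2 <= T.
  by apply: ub_le_sup; [exists 1|split=> //; apply/andP; split; lra].
by lra.
Qed.

Lemma connected_itv_cc (a b : R) : connected `[a, b]%classic.
Proof. by apply/connected_intervalP; exact: interval_is_interval. Qed.

End LocallyConstant.

(** * Extending local primitives over the square of a homotopy *)

Section Monodromy.
Context {R : realType} {M : topologicalType} {I : Type}.
Variables (U : I -> set M) (f : I -> M -> R).
Hypothesis openU : forall i, open (U i).
Hypothesis coverU : forall p, exists i, U i p.
Hypothesis overlap : forall i j p, U i p -> U j p ->
  \forall q \near p, f i q - f j q = f i p - f j p.
Variable H : R * R -> M.
Let S : set (R * R) := `[0, 1]%classic `*` `[0, 1]%classic.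
Hypothesis contH : {within S, continuous H}.

Let near_H z (A : set M) : S z -> nbhs (H z) A -> \forall z' \near z, S z' -> A (H z').
Proof.
by move=> Sz nA; exact: ((subspace_continuousP _ _).1 contH z Sz A nA).
Qed.

(** A primitive over [A] of the closed form pulled back by [H], where the form is given only by the
    increments of its local primitives [f i]. *)
Definition is_lift (A : set (R * R)) (F : R * R -> R) := forall z, A z ->
  forall i, U i (H z) ->
  \forall z' \near z, A z' -> F z' - F z = f i (H z') - f i (H z).

Let lift_sub A B F : B `<=` A -> is_lift A F -> is_lift B F.
Proof.
move=> BA lF z Bz i Ui; have := lF z (BA z Bz) i Ui.
by apply: filterS => z' E /BA.
Qed.

Let lift_local A i : A `<=` S -> (forall z, A z -> U i (H z)) -> is_lift A (f i \o H).
Proof.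
move=> AS AU z Az j Uj.
have := near_H (AS z Az) (overlap (AU z Az) Uj).
apply: filterS => z' E Az'; have := E (AS z' Az') => /=; lra.
Qed.

(** On the connected intersection [F - G] is locally constant, hence a constant [c], and [F] glues
    with [G + c]. As both pieces are closed, a point of only one of them has a neighbourhood that
    misses the other. *)
Let lift_glue A B F G : A `<=` S -> B `<=` S -> closed A -> closed B ->
  connected (A `&` B) -> is_lift A F -> is_lift B G ->
  exists K, is_lift (A `|` B) K.
Proof.
move=> AS BS cA cB cAB lF lG.
have [c Hc] : exists c, forall z, A z -> B z -> F z = G z + c.
  have [[w [Aw Bw]]|nAB] := pselect (exists z, A z /\ B z); last first.
    by exists 0 => z Az Bz; exfalso; apply: nAB; exists z.
  exists (F w - G w) => z Az Bz.
  have := @locally_constant_connected _ _ (A `&` B) (fun z => F z - G z) cAB _ z w.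
  move=> /(_ _ (conj Az Bz) (conj Aw Bw)) <-; first by rewrite addrC subrK.
  move=> y [Ay By]; have [i Ui] := coverU (H y).
  apply: filterS2 (lF y Ay i Ui) (lG y By i Ui) => y' E1 E2 [Ay' By'].
  have := E1 Ay'; have := E2 By'; lra.
pose K z := if `[< A z >] then F z else G z + c.
have KA z : A z -> K z = F z by move=> Az; rewrite /K; case: asboolP.
have KB z : B z -> K z = G z + c.
  by move=> Bz; rewrite /K; case: asboolP => // Az; exact: Hc.
have lKA z i : A z -> U i (H z) ->
    \forall z' \near z, A z' -> K z' - K z = f i (H z') - f i (H z).
  move=> Az Ui; apply: filterS (lF z Az i Ui) => z' E Az'.
  by rewrite !KA//; exact: E.
have lKB z i : B z -> U i (H z) ->
    \forall z' \near z, B z' -> K z' - K z = f i (H z') - f i (H z).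
  move=> Bz Ui; apply: filterS (lG z Bz i Ui) => z' E Bz'.
  by rewrite !KB//; have := E Bz'; lra.
have away (C : set (R * R)) z : closed C -> ~ C z -> \forall z' \near z, ~ C z'.
  by move=> cC nC; apply: open_nbhs_nbhs; split=> //; exact: closed_openC.
exists K => z ABz i Ui.
have [Az|nA] := pselect (A z); have [Bz|nB] := pselect (B z).
- apply: filterS2 (lKA z i Az Ui) (lKB z i Bz Ui) => z' E1 E2 [Az'|Bz']; auto.
- apply: filterS2 (lKA z i Az Ui) (away _ _ cB nB) => z' E1 nB' [Az'|Bz'];
    first exact: E1.
  by exfalso; exact: nB'.
- apply: filterS2 (lKB z i Bz Ui) (away _ _ cA nA) => z' E1 nA' [Az'|Bz']; last exact: E1.
  by exfalso; exact: nA'.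
- by exfalso; case: ABz.
Qed.

Let rect (a b c d : R) : set (R * R) := `[a, b]%classic `*` `[c, d]%classic.

Let rectE a b c d z : rect a b c d z <-> (a <= z.1 <= b) /\ (c <= z.2 <= d).
Proof. by rewrite /rect /= !in_itv /=. Qed.

Let closed_rect a b c d : closed (rect a b c d).
Proof.
have -> : rect a b c d = fst @^-1` `[a, b]%classic `&` snd @^-1` `[c, d]%classic by [].
apply: closedI; apply: closed_comp => [z _|]; try exact: itv_closed.
  exact: cvg_fst.
exact: cvg_snd.
Qed.

Let connected_edge (g : R -> R * R) a b : continuous g ->
  connected (g @` `[a, b]%classic).
Proof.
by move=> cg; apply: connected_continuous_connected;
  [exact: connected_itv_cc|exact: continuous_subspaceT].
Qed.

Let glue_vertical a b c d e F G : 0 <= a -> b <= 1 -> 0 <= c -> c <= d -> d <= e ->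
    e <= 1 ->
  is_lift (rect a b c d) F -> is_lift (rect a b d e) G ->
  exists K, is_lift (rect a b c e) K.
Proof.
move=> a0 b1 c0 cd de e1 lF lG.
have [| | | K lK] := @lift_glue (rect a b c d) (rect a b d e) F G _ _
  (@closed_rect _ _ _ _) (@closed_rect _ _ _ _) _ lF lG.
- by move=> z /rectE[/andP[? ?] /andP[? ?]]; apply/rectE; split; apply/andP; split; lra.
- by move=> z /rectE[/andP[? ?] /andP[? ?]]; apply/rectE; split; apply/andP; split; lra.
- rewrite (_ : _ `&` _ = (fun s => (s, d)) @` `[a, b]%classic).
    apply: connected_edge => s.
    apply: (@cvg_pair _ _ _ (nbhs s) (nbhs s) (nbhs d) _ _ _ id (cst d));
        [exact: cvg_id|exact: cvg_cst].
  apply/seteqP; split=> [[s t] [/rectE[/= sab tcd] /rectE[/= _ tde]]|_ [s sab <-]].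
    exists s; first by rewrite /= in_itv.
    by congr pair; move: tcd tde => /andP[_ ?] /andP[? _]; apply/eqP; rewrite eq_le;
        apply/andP.
  move: sab; rewrite /= in_itv/= => sab.
  by split; apply/rectE; split=> //=; rewrite lexx ?cd ?de.
exists K; apply: lift_sub lK => z /rectE[sab /andP[ct te]].
have [td|dt] := leP z.2 d; [left|right]; apply/rectE; split=> //.
  by rewrite ct.
by rewrite (ltW dt).
Qed.

Let glue_horizontal a b c F G : 0 <= a -> a <= b -> b <= c -> c <= 1 ->
  is_lift (rect a b 0 1) F -> is_lift (rect b c 0 1) G ->
  exists K, is_lift (rect a c 0 1) K.
Proof.
move=> a0 ab bc c1 lF lG.
have [| | | K lK] := @lift_glue (rect a b 0 1) (rect b c 0 1) F G _ _
  (@closed_rect _ _ _ _) (@closed_rect _ _ _ _) _ lF lG.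
- by move=> z /rectE[/andP[? ?] /andP[? ?]]; apply/rectE; split; apply/andP; split; lra.
- by move=> z /rectE[/andP[? ?] /andP[? ?]]; apply/rectE; split; apply/andP; split; lra.
- rewrite (_ : _ `&` _ = (fun t => (b, t)) @` `[0, 1]%classic).
    apply: connected_edge => s.
    apply: (@cvg_pair _ _ _ (nbhs s) (nbhs b) (nbhs s) _ _ _ (cst b) id);
        [exact: cvg_cst|exact: cvg_id].
  apply/seteqP; split=> [[s t] [/rectE[/= sab t01] /rectE[/= sbc _]]|_ [t t01 <-]].
    exists t; first by rewrite /= in_itv.
    by congr pair; move: sab sbc => /andP[_ ?] /andP[? _]; apply/eqP; rewrite eq_le;
        apply/andP.
  move: t01; rewrite /= in_itv/= => t01.
  by split; apply/rectE; split=> //=; rewrite lexx ?ab ?bc.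
exists K; apply: lift_sub lK => z /rectE[/andP[az zc] t01].
have [zb|bz] := leP z.1 b; [left|right]; apply/rectE; split=> //.
  by rewrite az.
by rewrite (ltW bz).
Qed.

Let local_box s t : S (s, t) -> exists i, exists2 e : R, 0 < e &
  forall z, S z -> `|z.1 - s| < e -> `|z.2 - t| < e -> U i (H z).
Proof.
move=> Sst; have [i Ui] := coverU (H (s, t)); exists i.
have nU : nbhs (H (s, t)) (U i) by exact: open_nbhs_nbhs.
have /nbhs_ballP[e /= e0 He] := near_H Sst nU.
exists e => // z Sz z1 z2; apply: He => //.
by split; rewrite /ball/= distrC.
Qed.

(** Real induction on the height: each step glues a box on top of the strip and may shrink the width
    [e]. *)
Let strip s : 0 <= s <= 1 -> exists2 e : R, 0 < e & exists F, forall a b,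
  0 <= a -> b <= 1 -> s - e <= a -> b <= s + e -> is_lift (rect a b 0 1) F.
Proof.
move=> s01.
(* Here the lift may depend on [a] and [b]; at height 1 the widest rectangle gives one lift for all
   narrower ones. *)
pose P t := exists2 e : R, 0 < e & forall a b,
  0 <= a -> b <= 1 -> s - e <= a -> b <= s + e -> exists F, is_lift (rect a b 0 t) F.
suff [e e0 He] : P 1.
  exists e => //.
  pose a := Num.max 0 (s - e); pose b := Num.min 1 (s + e).
  have [||||F lF] := He a b; rewrite ?le_max ?ge_min ?lexx ?orbT//.
  exists F => a' b' a0 b1 a'e b'e; apply: lift_sub lF => z /rectE[/andP[az zb] t01].
  apply/rectE; split=> //; rewrite ge_max le_min.
  by rewrite (le_trans a0 az) (le_trans a'e az) (le_trans zb b1) (le_trans zb b'e).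
apply: real_induction.
  have [|i [e e0 He]] := @local_box s 0; first by apply/rectE; rewrite /= lexx ler01.
  exists (e / 2); first by rewrite divr_gt0.
  move=> a b a0 b1 ae be; exists (f i \o H).
  have sub : rect a b 0 0 `<=` S.
    by move=> z /rectE[/andP[? ?] /andP[? ?]]; apply/rectE; split; apply/andP; split; lra.
  apply: lift_local => // z /[dup]/sub Sz /rectE[/andP[? ?] /andP[? ?]].
  by apply: He => //; rewrite ltr_norml; apply/andP; split; lra.
move=> t t01; have [|i [e e0 He]] := @local_box s t; first by apply/rectE.
exists e => // u v u0 uv v1 ut vt [d d0 Hd].
exists (Num.min d (e / 2)); first by rewrite lt_min d0 divr_gt0.
move=> a b a0 b1; rewrite lerBlDr -lerBlDl le_min => /andP[ad ae].
rewrite -lerBlDl le_min => /andP[bd be].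
have [|||| F lF] := Hd a b => //; try lra.
apply: (glue_vertical _ _ _ _ _ _ lF (_ : is_lift (rect a b u v) (f i \o H))) => //.
have sub : rect a b u v `<=` S.
  by move=> z /rectE[/andP[? ?] /andP[? ?]]; apply/rectE; split; apply/andP; split; lra.
move: ut vt; rewrite !ltr_norml => /andP[? ?] /andP[? ?].
apply: lift_local => // z /[dup]/sub Sz /rectE[/andP[? ?] /andP[? ?]].
by apply: He => //; rewrite ltr_norml; apply/andP; split; lra.
Qed.

Lemma square_lift : exists F, is_lift S F.
Proof.
pose P s := exists F, is_lift (rect 0 s 0 1) F.
suff : P 1 by [].
apply: real_induction.
  have [|e e0 [F HF]] := @strip 0; first by rewrite lexx ler01.
  by exists F; apply: HF; lra.
move=> s s01; have [e e0 [G HG]] := strip s01.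
exists e => // u v u0 uv v1; rewrite !ltr_norml => /andP[? ?] /andP[? ?] [F lF].
by apply: (glue_horizontal _ _ _ _ lF (_ : is_lift (rect u v 0 1) G)) => //;
    apply: HG; lra.
Qed.

(** The increments of a lift along the sides of the square add up to zero. Three sides are sent to
    [p] and contribute nothing; the fourth contributes [L]. *)
Lemma monodromy_trivial (p : M) (L : R) :
  (forall t, 0 <= t <= 1 -> H (1, t) = p) ->
  (forall s, 0 <= s <= 1 -> H (s, 0) = p /\ H (s, 1) = p) ->
  (forall t i, 0 <= t <= 1 -> U i (H (0, t)) -> \forall t' \near t,
     0 <= t' <= 1 -> f i (H (0, t')) - f i (H (0, t)) = (t' - t) * L) ->
  L = 0.
Proof.
move=> H1 Hs H0; have [F lF] := square_lift.
(* Along such a side the lift minus [t * m] is locally constant on [0, 1]. *)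
have edge (g : R -> R * R) (m : R) : continuous g ->
    (forall t, 0 <= t <= 1 -> S (g t)) ->
    (forall t i, 0 <= t <= 1 -> U i (H (g t)) -> \forall t' \near t,
      0 <= t' <= 1 -> f i (H (g t')) - f i (H (g t)) = (t' - t) * m) ->
    F (g 1) - F (g 0) = m.
  move=> cg Sg Hg.
  have E := @locally_constant_connected R R `[0, 1]%classic
    (fun t => F (g t) - t * m) (@connected_itv_cc R 0 1) _ 1 0.
  have : F (g 1) - 1 * m = F (g 0) - 0 * m.
    apply: E; rewrite /= ?in_itv/= ?lexx ?ler01// => t; rewrite in_itv/= => t01.
    have [i Ui] := coverU (H (g t)).
    apply: filterS2 (Hg t i t01 Ui) (cg t _ (lF (g t) (Sg t t01) i Ui)) => t' E1 /= E2.
    rewrite in_itv/= => t'01; have := E1 t'01; have := E2 (Sg t' t'01); lra.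
  lra.
have pair_l (s : R) : continuous (fun t : R => (s, t)).
  move=> t; apply: (@cvg_pair _ _ _ (nbhs t) (nbhs s) (nbhs t) _ _ _ (cst s) id);
      [exact: cvg_cst|exact: cvg_id].
have pair_r (t : R) : continuous (fun s : R => (s, t)).
  move=> s; apply: (@cvg_pair _ _ _ (nbhs s) (nbhs s) (nbhs t) _ _ _ id (cst t));
      [exact: cvg_id|exact: cvg_cst].
have E0 : F (0, 1) - F (0, 0) = L.
  apply: (edge (fun t => (0, t))) => // t t01.
  by apply/rectE; rewrite /= lexx ler01.
have E1 : F (1, 1) - F (1, 0) = 0.
  apply: (edge (fun t => (1, t))) => // [t t01|t i t01 _].
    by apply/rectE; rewrite /= lexx ler01.
  by apply: (@filterE _ (nbhs t)) => t' t'01; rewrite !H1// subrr mulr0.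
have E2 : F (1, 0) - F (0, 0) = 0.
  apply: (edge (fun s => (s, 0))) => // [t t01|t i t01 _].
    by apply/rectE; rewrite /= lexx ler01.
  by apply: (@filterE _ (nbhs t)) => t' t'01; rewrite !(Hs _ _).1// subrr mulr0.
have E3 : F (1, 1) - F (0, 1) = 0.
  apply: (edge (fun s => (s, 1))) => // [t t01|t i t01 _].
    by apply/rectE; rewrite /= lexx ler01.
  by apply: (@filterE _ (nbhs t)) => t' t'01; rewrite !(Hs _ _).2// subrr mulr0.
lra.
Qed.

End Monodromy.

(** * The holonomy group *)

Section Holonomy.
Context {R : realType} {n k : nat} {M : manifold R n}.
Variables (g : riemannian_metric M) (act : torus R k -> M -> M).
Hypothesis act_smooth : smooth_torus_action act.
Hypothesis act_isometric : isometric_action g act.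
Hypothesis act_free : free_action act.
Hypothesis M_connected : connected [set: M].
Implicit Types (c d : chart R n M) (s : 'rV[R]_k) (p q : M).
Local Notation a := (cover_act act).
Local Notation reach := (reach g act).

(** [sigma] plays the role of a local primitive of the connection form: it records a move of [p] in
    its orbit after which [q] is reached horizontally. Regularity along curves is the form in which
    holonomy paths are produced. *)
Definition patch p (c : chart R n M) (V : set M) (sigma : M -> 'rV[R]_k) :=
  [/\ atlas c, open V, V p, V `<=` cdom c &
      (forall q, V q -> reach (a (sigma q) p) q) /\
      (forall (q : R -> M) (al be : R), smooth_on `]al, be[%classic (cmap c \o q) ->
         (forall r, al < r < be -> V (q r)) ->
         forall r0, al < r0 < be -> exists v, strict_derive (sigma \o q) r0 v)].

Lemma chart_ball c x (A : set M) : ccod c x -> nbhs (cinv c x) A ->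
  exists2 e : R, 0 < e & forall y, `|y - x| < e -> ccod c y /\ A (cinv c y).
Proof.
move=> cx nA.
have : nbhs x [set y | ccod c y /\ A (cinv c y)].
  by apply: filterI; [exact: nbhs_ccod|apply: cinv_continuous_at].
move=> /nbhs_ballP[e /= e0 He]; exists e => // y ye; apply: He.
by rewrite -ball_normE /= distrC.
Qed.

Lemma patch_exists p : exists c V sigma, patch p c V sigma.
Proof.
have [c ac cp] := atlas_cover p.
have cx : ccod c (cmap c p) by exact: cmap_fun.
have [e e0 He] := chart_ball cx (filterT : nbhs _ [set: M]).
have [S [S1 S2]] := local_section act_smooth act_isometric act_free ac
    (fun y ye => (He y ye).1).
exists c, [set q | cdom c q /\ `|cmap c q - cmap c p| < e], (S \o cmap c); split=> //.
- rewrite openE => q [cq qe]; apply: filterI; first exact: nbhs_cdom.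
  have cc : {for q, continuous (fun q => `|cmap c q - cmap c p|)}.
    apply: (@continuous_comp _ _ _ (fun q => cmap c q - cmap c p) (fun v => `|v|));
        last exact: norm_continuous.
    by apply: cvgB; [exact: cmap_continuous_at|exact: cvg_cst].
  by apply: (cc [set r | r < e]); apply: open_nbhs_nbhs; split=> //; exact: open_lt.
- by split; rewrite // subrr normr0.
- by move=> q [].
split=> [q [cq qe]|q al be sq qV r0 r0ab].
  by have := S1 _ qe; rewrite !cmapK.
by apply: (S2 (cmap c \o q) al be) => // r /qV[].
Qed.

(** Within a patch every point is reached from the centre up to a move in the orbit, so the set of
    such [q] is open and closed in the connected space [M]. *)
Lemma orbits_reach_all p q : exists s, reach (a s p) q.
Proof.
have := @locally_constant_connected M bool setT
  (fun q => `[< exists s, reach (a s p) q >]) M_connected _ q p I I.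
suff loc : forall z, setT z -> \forall z' \near z, setT z' ->
    `[< exists s, reach (a s p) z' >] = `[< exists s, reach (a s p) z >].
  move=> /(_ loc) E; apply/asboolP; rewrite E; apply/asboolP; exists 0.
  by rewrite cover_act0//; exact: reach_refl.
move=> z _; have [c [V [sigma [ac oV Vz Vc [rV _]]]]] := patch_exists z.
have : nbhs z V by exact: open_nbhs_nbhs.
apply: filterS => z' Vz' _; have zz' := rV z' Vz'.
apply/idP/idP => /asboolP[s ps]; apply/asboolP.
  exists (- sigma z' + s); rewrite cover_actD//.
  have := reach_act act_smooth (- sigma z') (reach_trans ps (reach_sym zz')).
  by rewrite -[in X in reach _ X]cover_actD// addNr cover_act0.
exists (sigma z' + s); rewrite cover_actD//.
exact: reach_trans (reach_act act_smooth _ ps) zz'.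
Qed.

Definition holonomy : set 'rV[R]_k := [set s | forall p, reach (a s p) p].

(** A horizontal path from some [a t p] to [q] transports the relation from [p] to [q], since [t]
    commutes with [s]. *)
Lemma holonomy_of_point s p : reach (a s p) p -> holonomy s.
Proof.
move=> sp q; have [t tq] := orbits_reach_all p q.
apply: reach_trans (reach_act act_smooth s (reach_sym tq)) _.
by rewrite cover_actC//; apply: reach_trans (reach_act act_smooth t sp) tq.
Qed.

Lemma holonomy0 : holonomy 0.
Proof. by move=> p; rewrite cover_act0//; exact: reach_refl. Qed.

Lemma holonomyD s t : holonomy s -> holonomy t -> holonomy (s + t).
Proof.
move=> hs ht p; rewrite cover_actD//.
exact: reach_trans (reach_act act_smooth s (ht p)) (hs p).
Qed.

Lemma holonomyN s : holonomy s -> holonomy (- s).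
Proof.
move=> hs p; have := reach_act act_smooth (- s) (reach_sym (hs p)).
by rewrite -[in X in reach _ X]cover_actD// addNr cover_act0.
Qed.

(** Compares two patches at a common point [r]; the fixed offset [u] accounts for their different
    base points. *)
Lemma holonomy_diff s t p q r : reach (a s p) r -> reach (a t q) r ->
  forall u, reach (a u p) q -> holonomy (s - t - u).
Proof.
move=> sr tr u uq; apply: (@holonomy_of_point _ p).
have : reach (a s p) (a (t + u) p).
  apply: (reach_trans sr); apply: (reach_trans (reach_sym tr)).
  by rewrite cover_actD//; apply: reach_act => //; exact: reach_sym.
move=> /(reach_act act_smooth (- (t + u))).
by rewrite -!cover_actD// addNr cover_act0// addrC opprD addrA.
Qed.

(** A substitute for the Lie algebra of [holonomy]. *)
Definition holonomy_velocity (v : 'rV[R]_k) := exists h : R -> 'rV[R]_k,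
  [/\ h 0 = 0, strict_derive h 0 v &
      exists2 d : R, 0 < d & forall t : R, `|t| < d -> holonomy (h t)].

Lemma holonomy_velocity0 : holonomy_velocity 0.
Proof.
exists (cst 0); split=> //; last by exists 1 => // t _; exact: holonomy0.
move=> e e0; exists 1 => // s t _ _.
by rewrite subrr scaler0 subrr normr0 mulr_ge0// ltW.
Qed.

Lemma holonomy_velocity_linear (b : R) u v :
  holonomy_velocity u -> holonomy_velocity v -> holonomy_velocity (b *: u + v).
Proof.
move=> [h1 [h10 s1 [d1 d10 H1]]] [h2 [h20 s2 [d2 d20 H2]]].
exists (fun t => h1 (b * t) + h2 t); split.
- by rewrite mulr0 h10 h20 addr0.
- by apply: strict_deriveD => //; exact: strict_deriveZ.
have b1 : 0 < `|b| + 1 by rewrite ltr_wpDl.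
exists (Num.min (d1 / (`|b| + 1)) d2) => [|t]; first by rewrite lt_min d20 divr_gt0.
rewrite lt_min => /andP[t1 t2]; apply: holonomyD; last exact: H2.
apply: H1; move: t1; rewrite ltr_pdivlMr//; apply: le_lt_trans.
by rewrite normrM mulrC ler_wpM2l// lerDl.
Qed.

Lemma holonomy_full : (forall v, holonomy_velocity v) -> holonomy = setT.
Proof.
move=> hv.
have /choice[h Hh] : forall i : 'I_k, exists h : R -> 'rV[R]_k,
  [/\ h 0 = 0, strict_derive h 0 (delta_mx 0 i) &
      exists2 d : R, 0 < d & forall t : R, `|t| < d -> holonomy (h t)].
  by move=> i; exact: hv.
apply: (strict_paths_generate holonomy0 holonomyD (h := h)) => i; by case: (Hh i).
Qed.

Section Annihilator.
Variable l : 'cV[R]_k.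
Hypothesis vl : forall v, holonomy_velocity v -> v *m l = 0.

(** Translated back by its value at [r], the path runs in [holonomy] and passes through 0, so its
    velocity at [r] is a holonomy velocity and [l] kills it. *)
Lemma holonomy_path_constant (h : R -> 'rV[R]_k) (al be : R) u :
  (forall r, al < r < be -> holonomy (h r - u)) ->
  (forall r, al < r < be -> exists v, strict_derive h r v) ->
  forall r r', al < r < be -> al < r' < be -> h r *m l = h r' *m l.
Proof.
move=> hu hs; apply: (@is_derive_0_const_itv _ _ _ (fun r => h r *m l)) => r rab.
apply: strict_derive_is_derive; have [v hv] := hs r rab.
have <- : v *m l = 0; last exact: strict_derive_mulmx.
apply: vl; exists (fun t => h (r + t) + - h r); split.
- by rewrite addr0 subrr.
- exact: strict_derive_shift.
exists (Num.min (r - al) (be - r)) => [|t].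
  by move: rab => /andP[? ?]; rewrite lt_min !subr_gt0; apply/andP.
rewrite lt_min !ltr_norml => /andP[/andP[? ?] /andP[? ?]].
rewrite -(subrKA u); apply: holonomyD; last first.
  by rewrite -opprB; apply: holonomyN; exact: hu.
by apply: hu; apply/andP; split; lra.
Qed.

(** Along the segment from [q] to [q'] in the chart [c], the difference of [sigma] and [sigma']
    stays in one coset of [holonomy], so [l] is constant on it. *)
Lemma patch_overlap p p' c c' V V' sigma sigma' q :
  patch p c V sigma -> patch p' c' V' sigma' -> V q -> V' q ->
  \forall q' \near q, (sigma q' *m l) 0 0 - (sigma' q' *m l) 0 0 =
     (sigma q *m l) 0 0 - (sigma' q *m l) 0 0 :> R.
Proof.
move=> [ac oV Vp Vc [rV sV]] [ac' oV' Vp' Vc' [rV' sV']] Vq V'q.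
have cq := Vc _ Vq; have cx := cmap_fun cq; set x := cmap c q in cx *.
have nVV : nbhs (cinv c x) (V `&` V').
  by rewrite /x cmapK//; apply: filterI; exact: open_nbhs_nbhs.
have [e e0 He] := chart_ball cx nVV.
have : \forall q' \near q, cdom c q' /\ `|cmap c q' - x| < e.
  apply: filterI; first exact: nbhs_cdom.
  have /cvgrPdist_lt/(_ e e0) := cmap_continuous_at cq.
  by apply: filterS => q'; rewrite distrC.
apply: filterS => q' [cq' q'e].
have [e' e'0 He'] := segment_margin q'e.
pose y (r : R) := x + r *: (cmap c q' - x).
have ye r : - e' < r < 1 + e' -> `|y r - x| < e.
  by move=> re; rewrite /y addrAC subrr add0r; exact: He'.
have oI : open (`]- e', 1 + e'[%classic : set R) by exact: interval_open.
have sy : smooth_on `]- e', 1 + e'[%classic y.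
  exact: smooth_on_affine.
have y_in r : r \in `]- e', 1 + e'[ -> - e' < r < 1 + e' by rewrite in_itv.
have s1 : smooth_on `]- e', 1 + e'[%classic (cmap c \o (cinv c \o y)).
  by apply: smooth_on_eq sy => // r /y_in /ye/He[cy _]; rewrite /= cinvK.
(* [sigma'] is regular along curves that are smooth in its own chart [c'], hence the passage through
   the transition map. *)
have s2 : smooth_on `]- e', 1 + e'[%classic (cmap c' \o (cinv c \o y)).
  have otr : open [set x | ccod c x /\ cdom c' (cinv c x)].
    rewrite openE => z [cz c'z]; apply: filterI; first exact: nbhs_ccod.
    by apply: cinv_continuous_at => //; exact: nbhs_cdom.
  apply: (@smooth_on_compose _ _ _ _ (coord_mx _ _) (coord_mx _ _) _
    [set x | ccod c x /\ cdom c' (cinv c x)] y (cmap c' \o cinv c) oI otr _ sy).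
    by move=> r /y_in /ye/He[cy [_ /Vc']].
  exact: atlas_compatible.
have [u up] := orbits_reach_all p p'.
have := @holonomy_path_constant (fun r => sigma (cinv c (y r)) + - sigma' (cinv c (y r)))
  (- e') (1 + e') u.
move=> /(_ _ _ 1 0) H.
have {}H : (sigma (cinv c (y 1)) - sigma' (cinv c (y 1))) *m l =
    (sigma (cinv c (y 0)) - sigma' (cinv c (y 0))) *m l.
  apply: H; try (apply/andP; split; lra).
    move=> r /ye/He[cy [Vy V'y]]; exact: holonomy_diff (rV _ Vy) (rV' _ V'y) _ up.
  move=> r rab.
  have [v1 hv1] := sV (cinv c \o y) _ _ s1 (fun r rr => (He _ (ye r rr)).2.1) r rab.
  have [v2 hv2] := sV' (cinv c \o y) _ _ s2 (fun r rr => (He _ (ye r rr)).2.2) r rab.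
  by exists (v1 - v2); apply: strict_deriveD => //; exact: strict_deriveN.
have y1 : cinv c (y 1) = q' by rewrite /y scale1r addrC subrK cmapK.
have y0 : cinv c (y 0) = q by rewrite /y scale0r addr0 /x cmapK.
move: H; rewrite y1 y0 !mulmxBl => /matrixP/(_ 0 0).
by rewrite !mxE.
Qed.

(** The value of [l omega] on a Killing field. The point [a (r *: xi) p0] is reached from the orbit
    of [p] with parameter [sigma] and, trivially, from [p0] with parameter [r *: xi]; the difference
    of the two stays in one coset of [holonomy]. *)
Lemma patch_orbit p c V sigma p0 xi t : patch p c V sigma -> V (a (t *: xi) p0) ->
  \forall t' \near t,
    (sigma (a (t' *: xi) p0) *m l) 0 0 - (sigma (a (t *: xi) p0) *m l) 0 0 =
    (t' - t) * (xi *m l) 0 0 :> R.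
Proof.
move=> [ac oV Vp Vc [rV sV]] Vt.
have [d ad dp0] := atlas_cover p0.
have dx := cmap_fun dp0; set x := cmap d p0 in dx *.
have ct : continuous (fun r : R => a (r *: xi) p0) by exact: orbit_curve_continuous.
have nV : nbhs t ((fun r : R => a (r *: xi) p0) @^-1` V).
  by apply: ct; exact: open_nbhs_nbhs.
move/nbhs_ballP : nV => [e /= e0 He].
have HV r : t - e < r < t + e -> V (a (r *: xi) p0).
  by move=> re; apply: He; rewrite /ball/= ltr_norml; move: re => /andP[? ?];
      apply/andP; split; lra.
pose I : set R := `]t - e, t + e[%classic.
have oI : open I by exact: interval_open.
have I_in r : I r -> t - e < r < t + e by rewrite /I/= in_itv.
have sq : smooth_on I (cmap c \o (fun r : R => a (r *: xi) p0)).
  apply: (@smooth_on_eq _ _ _ _ (act_chart act d c \o (fun r : R =>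
      (0 + r *: xi, x)))) => //.
    by move=> r Ir; rewrite /act_chart/= /x cmapK// add0r.
  apply: (@smooth_on_compose _ _ _ _ (coord_pair (coord_mx _ _) (coord_mx _ _))
    (coord_mx _ _) _ (act_dom act d c)
    (fun r : R => (0 + r *: xi, x)) (act_chart act d c) oI).
  - exact: open_act_dom.
  - by move=> r /I_in/HV/Vc cr; split=> //=; rewrite /x cmapK// add0r.
  - apply: smooth_on_pair => //; last exact: smooth_on_cst.
    exact: smooth_on_affine.
  - exact: smooth_act_chart.
have [u up] := orbits_reach_all p p0.
have H r r' : t - e < r < t + e -> t - e < r' < t + e ->
    (sigma (a (r *: xi) p0) + r *: - xi) *m l =
    (sigma (a (r' *: xi) p0) + r' *: - xi) *m l.
  apply: (@holonomy_path_constant (fun r => sigma (a (r *: xi) p0) + r *: - xi) _ _ u).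
    move=> {r r'} r re; rewrite scalerN.
    apply: holonomy_diff (rV _ (HV r re)) _ _ up; exact: reach_refl.
  move=> {r r'} r re; have [v hv] := sV _ _ _ sq HV r re.
  exists (v + - xi); apply: strict_deriveD => // e1 e10; exists 1 => // s1 s2 _ _.
  by rewrite -scalerBl subrr normr0 mulr_ge0// ltW.
have : \forall t' \near t, t - e < t' < t + e.
  exists e => //= t'; rewrite /ball/= ltr_norml => /andP[? ?]; apply/andP; split; lra.
apply: filterS => t' t'e.
have := H t' t t'e; rewrite !mulmxDl => /(_ _)/matrixP/(_ 0 0) E.
have {}E := E ltac:(apply/andP; split; lra).
move: E; rewrite -!scalemxAl mulNmx !mxE; lra.
Qed.

End Annihilator.

Lemma holonomy_setT (p0 : M) : simply_connected R M -> holonomy = setT.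
Proof.
move=> [_ sc].
have [|[l l0 vl]] := proper_subspace_annihilator holonomy_velocity0
    holonomy_velocity_linear.
  exact: holonomy_full.
exfalso; move/eqP : l0; apply.
have /choice[P HP] : forall p, exists P : chart R n M * set M * (M -> 'rV[R]_k),
    patch p P.1.1 P.1.2 P.2.
  by move=> p; have [c [V [sigma H]]] := patch_exists p; exists (c, V, sigma).
apply/matrixP => j j0; rewrite (ord1 j0) mxE {j0}.
(* An integral vector, so its orbit curve on [0, 1] is a loop. *)
pose xi : 'rV[R]_k := delta_mx 0 j.
have -> : l j 0 = (xi *m l) 0 0 by rewrite -rowE mxE.
have cl : continuous (fun r : R => a (r *: xi) p0) by exact: orbit_curve_continuous.
have [|H [cH H0 H1 Hs]] := sc p0 (fun r : R => a (r *: xi) p0).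
  split; first exact: continuous_subspaceT.
    by rewrite scale0r cover_act0.
  rewrite scale1r; apply: cover_act_int => //.
  by apply/mxOverP => i i'; rewrite mxE; case: (_ && _); rewrite ?rpred0 ?rpred1.
(* The covering is indexed by the points of [M], each with its chosen patch and the local primitive
   of [l omega] that this patch carries. *)
apply: (@monodromy_trivial R M M (fun p => (P p).1.2) (fun p q => ((P p).2 q *m l) 0 0)
  _ _ _ H cH p0).
- by move=> p; have [] := HP p.
- by move=> p; exists p; have [] := HP p.
- by move=> p p' q; exact: patch_overlap vl _ _ _ _ _ _ _ _ _ (HP p) (HP p').
- by move=> t t01; apply: H1; rewrite in_itv.
- by move=> s s01; apply: Hs; rewrite in_itv.
move=> t p t01; rewrite H0 ?in_itv// => Vt.
have := patch_orbit vl (HP p) Vt.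
by apply: filterS => t' E t'01; rewrite H0 ?in_itv.
Qed.

End Holonomy.

Theorem theorem4 (R : realType) (n k : nat) (M : manifold R n)
    (g : riemannian_metric M) (act : torus R k -> M -> M)
    (M_connected : connected [set: M])
    (sec_ge0 : nonneg_sectional_curvature g)
    (act_smooth : smooth_torus_action act)
    (act_isometric : isometric_action g act)
    (act_free : free_action act)
    (M_simply_connected : simply_connected R M) :
  twisted g (orbit_proj act).
Proof.
move=> p q; apply: reach_dual_leaf => //.
have full := holonomy_setT act_smooth act_isometric act_free M_connected p
    M_simply_connected.
have [s spq] := orbits_reach_all act_smooth act_isometric act_free M_connected p q.
have sH : holonomy g act s by rewrite full.
(* The point [p] first reaches [a s p] in its own orbit, by holonomy, and from there [q]. *)
exact: reach_trans (reach_sym (sH p)) spq.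
Qed.
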